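(* Let $n\ge1$ and let $\Lambda$ be a finite dimensional algebra with $\operatorname{gl.dim}\Lambda\le n$. If $\mathcal C$ is an absolute $n$-cluster tilting subcategory of $\operatorname{mod}\Lambda$, then $$\mathcal C[n\mathbb Z]:=\operatorname{add}\{X[\ell n]\mid X\in\mathcal C,\ \ell\in\mathbb Z\}$$ is an $n$-cluster tilting subcategory of $\mathcal D:=\mathrm K^{\rm b}(\operatorname{pr}\Lambda)$.
   Context: Conventions: modules are finitely generated right modules; subcategories are full and closed under isomorphism, direct sums and direct summands; $\operatorname{add}$ denotes closure under finite direct sums and direct summands. $\mathrm K^{\rm b}(\operatorname{pr}\Lambda)$ is the homotopy category of bounded complexes of finitely generated projective $\Lambda$-modules, identified with the corresponding subcategory of the derived category of $\Lambda$ (for $\operatorname{gl.dim}\Lambda<\infty$ it contains $\operatorname{mod}\Lambda$ as stalk complexes in degree $0$). An absolute $n$-cluster tilting subcategory of $\operatorname{mod}\Lambda$ is a functorially finite subcategory $\mathcal C$ of $\operatorname{mod}\Lambda$ with $\mathcal C=\{X\in\operatorname{mod}\Lambda\mid\operatorname{Ext}^i_\Lambda(X,\mathcal C)=0\ (0<i<n)\}=\{X\in\operatorname{mod}\Lambda\mid\operatorname{Ext}^i_\Lambda(\mathcal C,X)=0\ (0<i<n)\}$. A functorially finite subcategory $\mathcal B$ of $\mathcal D$ is $n$-cluster tilting if $\mathcal B=\{X\in\mathcal D\mid\operatorname{Hom}_{\mathcal D}(X,\mathcal B[i])=0\ (0<i<n)\}=\{X\in\mathcal D\mid\operatorname{Hom}_{\mathcal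 D}(\mathcal B,X[i])=0\ (0<i<n)\}$. *)

(* Defs.v *)
From HB Require Import structures.
From mathcomp Require Import all_boot all_order all_algebra all_field.

Set Implicit Arguments.
Unset Strict Implicit.
Unset Printing Implicit Defensive.

Import Order.TTheory GRing.Theory Num.Theory.
Local Open Scope ring_scope.

(* The data of a category in which equality of morphisms is a relation (so
   that homotopy classes need no quotient type), together with a zero object
   and binary direct sums.  It is only used at the two instances [modcat] and
   [Kbcat] below. *)
Record catData := CatData {
  obj :> Type;
  hom : obj -> obj -> Type;
  heq : forall X Y, hom X Y -> hom X Y -> Prop;
  idm : forall X, hom X X;
  comp : forall X Y Z, hom Y Z -> hom X Y -> hom X Z;
  zobj : obj;
  dsum : obj -> obj -> obj
}.
Arguments idm {_} X.
Arguments comp {_ X Y Z} g f.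
Arguments zobj {_}.
Arguments dsum {_} X Y.

Section Subcategories.
Variable A : catData.
Implicit Types (B S : A -> Prop) (X Y : A).

Definition iso X Y : Prop :=
  exists (f : hom X Y) (g : hom Y X),
    heq (comp g f) (idm X) /\ heq (comp f g) (idm Y).

(* Full subcategories, closed under isomorphisms, finite direct sums and
   direct summands, given by their objects. *)
Definition subcategory B : Prop :=
  [/\ B zobj,
      forall X Y, iso X Y -> B X -> B Y,
      forall X Y, B X -> B Y -> B (dsum X Y) &
      forall X Y, B (dsum X Y) -> B X].

Inductive add S : A -> Prop :=
| add_gen X : S X -> add S X
| add_zero : add S zobj
| add_iso X Y : iso X Y -> add S X -> add S Y
| add_dsum X Y : add S X -> add S Y -> add S (dsum X Y)
| add_summand X Y : add S (dsum X Y) -> add S X.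

Definition contravariantly_finite B : Prop :=
  forall X, exists (Y : A) (f : hom Y X), B Y /\
    forall (Y' : A) (g : hom Y' X), B Y' ->
      exists h : hom Y' Y, heq (comp f h) g.

Definition covariantly_finite B : Prop :=
  forall X, exists (Y : A) (f : hom X Y), B Y /\
    forall (Y' : A) (g : hom X Y'), B Y' ->
      exists h : hom Y Y', heq (comp h f) g.

Definition functorially_finite B : Prop :=
  contravariantly_finite B /\ covariantly_finite B.

End Subcategories.

Definition mklin (R : nzRingType) (U V : lmodType R) (f : U -> V)
    (hf : linear f) : {linear U -> V} :=
  HB.pack f (GRing.isLinear.Build R U V *:%R f hf).

(* A right module over R is a left module over the converse ring R^c. *)
Section Modules.
Variable R : nzRingType.
Local Notation rmod := (lmodType R^c).

Definition finitely_generated (M : rmod) : Prop :=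
  exists (m : nat) (e : 'I_m -> M), forall x : M,
    exists c : 'I_m -> R^c, x = \sum_(i < m) c i *: e i.

Definition projective (P : rmod) : Prop :=
  forall (M N : rmod) (g : {linear M -> N}) (f : {linear P -> N}),
    (forall y, exists x, g x = y) ->
    exists h : {linear P -> M}, forall x, g (h x) = f x.

Definition is_pr (P : rmod) : Prop := finitely_generated P /\ projective P.

Definition is_zero (M : rmod) : Prop := forall x : M, x = 0.

Definition rmod0 : rmod := 'rV[R^c]_0.

Lemma rmod0_is_zero : is_zero rmod0.
Proof. by move=> x; apply/rowP; case. Qed.

Lemma fg_zero (M : rmod) : is_zero M -> finitely_generated M.
Proof.
move=> M0; exists 0%N, (fun=> 0) => x; exists (fun=> 0).
by rewrite big_ord0; apply: M0.
Qed.

Lemma is_pr0 : is_pr rmod0.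
Proof.
split; first exact/fg_zero/rmod0_is_zero.
move=> M N g f _; exists \0 => x.
by rewrite [x]rmod0_is_zero !linear0.
Qed.

Lemma fg_prod (M N : rmod) :
  finitely_generated M -> finitely_generated N ->
  finitely_generated (M * N)%type.
Proof.
move=> [m [e eP]] [n [e' eP']]; exists (m + n)%N.
exists (fun i => match split i with inl j => (e j, 0) | inr j => (0, e' j) end).
move=> [x y]; have [c ->] := eP x; have [c' ->] := eP' y.
exists (fun i => match split i with inl j => c j | inr j => c' j end).
rewrite big_split_ord /=.
under [X in _ = X + _]eq_bigr => i _ do rewrite (unsplitK (inl i ) : split (lshift n i) = inl i).
under [X in _ = _ + X]eq_bigr => i _ do rewrite (unsplitK (inr i ) : split (rshift m i) = inr i).
have fstS (I : finType) (F : I -> M * N) : (\sum_i F i).1 = \sum_i (F i).1.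
  by apply: (big_morph (@fst M N)).
have sndS (I : finType) (F : I -> M * N) : (\sum_i F i).2 = \sum_i (F i).2.
  by apply: (big_morph (@snd M N)).
rewrite [RHS]surjective_pairing /=; congr pair.
  rewrite !fstS /= [X in _ = _ + X]big1 ?addr0// => i _; exact: scaler0.
rewrite !sndS /= [X in _ = X + _]big1 ?add0r// => i _; exact: scaler0.
Qed.

Lemma projective_prod (P Q : rmod) :
  projective P -> projective Q -> projective (P * Q)%type.
Proof.
move=> hP hQ M N g f gs.
have l1 : linear (fun x : P => f (x, 0)).
  move=> a x y; rewrite -linearP; congr (f _); congr pair => /=.
  by rewrite scaler0 addr0.
have l2 : linear (fun y : Q => f (0, y)).
  move=> a x y; rewrite -linearP; congr (f _); congr pair => /=.
  by rewrite scaler0 addr0.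
have [h1 h1P] := hP _ _ g (mklin l1) gs.
have [h2 h2P] := hQ _ _ g (mklin l2) gs.
have l : linear (fun p : P * Q => h1 p.1 + h2 p.2).
  by move=> a x y; rewrite !linearP /= scalerDr addrACA.
exists (mklin l) => -[x y] /=.
rewrite linearD h1P h2P /= -linearD; congr (f _); congr pair => /=.
  by rewrite addr0.
by rewrite add0r.
Qed.

Lemma is_pr_prod (P Q : rmod) : is_pr P -> is_pr Q -> is_pr (P * Q)%type.
Proof.
by move=> [? ?] [? ?]; split; [apply: fg_prod | apply: projective_prod].
Qed.

Record fgmod := FgMod {
  fgmod_sort :> rmod;
  fgmodP : finitely_generated fgmod_sort
}.

Definition modcat : catData := {|
  obj := fgmod;
  hom := fun M N => {linear M -> N};
  heq := fun M N f g => forall x : M, f x = g x;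
  idm := fun M => idfun;
  comp := fun M N P g f => g \o f;
  zobj := FgMod (fg_zero rmod0_is_zero);
  dsum := fun M N => FgMod (fg_prod (fgmodP M) (fgmodP N))
|}.

(* Cochain complexes.  The differential is given between any two degrees, and
   vanishes unless the second is the successor of the first; this avoids all
   transports along equalities between degrees. *)
Record complex := Complex {
  term :> int -> rmod;
  diff : forall i j, {linear term i -> term j};
  diff_deg : forall i j, j != i + 1 -> forall x, diff i j x = 0;
  diff2 : forall i j l x, diff j l (diff i j x) = 0
}.
Arguments diff X i j : rename.

Record chain_map (X Y : complex) := ChainMap {
  cm :> forall i, {linear X i -> Y i};
  cmP : forall i j x, cm j (diff X i j x) = diff Y i j (cm i x)
}.

Program Definition id_map (X : complex) : chain_map X X :=
  @ChainMap X X (fun i => idfun) _.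
Next Obligation. by []. Qed.

Program Definition comp_map (X Y Z : complex) (g : chain_map Y Z)
    (f : chain_map X Y) : chain_map X Z :=
  @ChainMap X Z (fun i => g i \o f i) _.
Next Obligation. by move=> X Y Z g f i j x /=; rewrite !cmP. Qed.

Program Definition zero_map (X Y : complex) : chain_map X Y :=
  @ChainMap X Y (fun i => \0) _.
Next Obligation. by move=> X Y i j x /=; rewrite linear0. Qed.

Definition homotopic (X Y : complex) (f g : chain_map X Y) : Prop :=
  exists h : forall i j, {linear X i -> Y j}, forall i (x : X i),
    f i x - g i x = diff Y (i - 1) i (h i (i - 1) x)
                    + h (i + 1) i (diff X i (i + 1) x).

(* f induces injective and surjective maps on all cohomology groups. *)
Definition quasi_iso (X Y : complex) (f : chain_map X Y) : Prop :=
  forall i,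
    (forall x : X i, diff X i (i + 1) x = 0 ->
       (exists y, f i x = diff Y (i - 1) i y) ->
       exists x', x = diff X (i - 1) i x') /\
    (forall y : Y i, diff Y i (i + 1) y = 0 ->
       exists x y', diff X i (i + 1) x = 0 /\
                    y = f i x + diff Y (i - 1) i y').

(* X and Y are isomorphic in the derived category: an isomorphism there is
   represented by a roof X <- Z -> Y both of whose legs are
   quasi-isomorphisms. *)
Definition derived_iso (X Y : complex) : Prop :=
  exists (Z : complex) (s : chain_map Z X) (f : chain_map Z Y),
    quasi_iso s /\ quasi_iso f.

(* X[l]: the term of degree i is X^(i+l), with differential (-1)^l d_X. *)
Program Definition shift (X : complex) (l : int) : complex :=
  @Complex (fun i => X (i + l))
    (fun i j => if odd `|l|%N
                then \- diff X (i + l) (j + l) : {linear _ -> _}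
                else diff X (i + l) (j + l)) _ _.
Next Obligation.
move=> X l i j ij x.
have h : diff X (i + l) (j + l) x = 0.
  by apply: diff_deg; rewrite addrAC (can_eq (addrK l)).
by case: ifP => _ //=; rewrite h oppr0.
Qed.
Next Obligation.
by move=> X l i j m x; case: odd => /=; rewrite ?(linearN (diff X _ _)) diff2 ?oppr0.
Qed.

Definition stalk_term (M : rmod) (i : int) : rmod :=
  if i is Posz 0 then M else rmod0.

Program Definition stalk (M : rmod) : complex :=
  @Complex (stalk_term M) (fun i j => \0) _ _.
Next Obligation. by []. Qed.
Next Obligation. by []. Qed.

Definition prod_fun (U V U' V' : rmod) (f : {linear U -> U'})
  (g : {linear V -> V'}) (p : U * V) : U' * V' := (f p.1, g p.2).

Lemma prod_fun_linear (U V U' V' : rmod) (f : {linear U -> U'})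
  (g : {linear V -> V'}) : linear (prod_fun f g).
Proof. by move=> a x y; rewrite /prod_fun !linearP. Qed.

Program Definition complex_sum (X Y : complex) : complex :=
  @Complex (fun i => (X i * Y i)%type)
    (fun i j => mklin (prod_fun_linear (diff X i j) (diff Y i j))) _ _.
Next Obligation.
by move=> X Y i j ij [x y]; rewrite /= /prod_fun /= !(diff_deg ij).
Qed.
Next Obligation. by move=> X Y i j l [x y]; rewrite /= /prod_fun /= !diff2. Qed.

Program Definition complex0 : complex :=
  @Complex (fun=> rmod0) (fun i j => \0) _ _.
Next Obligation. by []. Qed.
Next Obligation. by []. Qed.

Definition bounded (X : complex) : Prop :=
  exists N : nat, forall i : int, (N < `|i|)%N -> is_zero (X i).

Record kbpr := KbPr {
  kbpr_complex :> complex;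
  kbpr_bounded : bounded kbpr_complex;
  kbpr_pr : forall i, is_pr (kbpr_complex i)
}.

Program Definition kbpr0 : kbpr := @KbPr complex0 _ (fun=> is_pr0).
Next Obligation. by exists 0%N => i _; apply: rmod0_is_zero. Qed.

Program Definition kbpr_sum (X Y : kbpr) : kbpr :=
  @KbPr (complex_sum X Y) _ (fun i => is_pr_prod (kbpr_pr X i) (kbpr_pr Y i)).
Next Obligation.
move=> X Y; have [m mP] := kbpr_bounded X; have [n nP] := kbpr_bounded Y.
exists (maxn m n) => i; rewrite gtn_max => /andP[mi ni] [x y].
by rewrite (mP i mi x) (nP i ni y).
Qed.

Program Definition kbpr_shift (X : kbpr) (l : int) : kbpr :=
  @KbPr (shift X l) _ (fun i => kbpr_pr X (i + l)).
Next Obligation.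
move=> X l; have [m mP] := kbpr_bounded X.
exists (m + `|l|)%N => i il; apply: mP.
rewrite -(ltn_add2r `|l|%N); apply: leq_trans il _.
by by rewrite -lez_nat PoszD !abszE -{1}(addrK l i) ler_normB.
Qed.

Definition Kbcat : catData := {|
  obj := kbpr;
  hom := fun X Y => chain_map X Y;
  heq := fun X Y f g => homotopic f g;
  idm := fun X => id_map X;
  comp := fun X Y Z g f => comp_map g f;
  zobj := kbpr0;
  dsum := kbpr_sum
|}.

(* A projective resolution of M in mod R, placed in degrees <= 0. *)
Definition proj_resolution (P : complex) (M : rmod) : Prop :=
  [/\ forall i, is_pr (P i),
      forall i : int, 0 < i -> is_zero (P i) &
      exists f : chain_map P (stalk M), quasi_iso f].

Definition gldim_le (n : nat) : Prop :=
  forall M : fgmod, exists P : complex,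
    proj_resolution P M /\ forall i : int, i < - n%:Z -> is_zero (P i).

(* Ext^i(M, N) = H^i(Hom(P, N)) = 0 for the projective resolutions P of M. *)
Definition ext_eq0 (i : nat) (M N : rmod) : Prop :=
  forall P : complex, proj_resolution P M ->
  forall f : {linear P (- i%:Z) -> N},
    (forall x, f (diff P (- i%:Z - 1) (- i%:Z) x) = 0) ->
    exists g : {linear P (- i%:Z + 1) -> N},
      forall x, f x = g (diff P (- i%:Z) (- i%:Z + 1) x).

Definition abs_cluster_tilting (n : nat) (C : modcat -> Prop) : Prop :=
  [/\ subcategory C,
      functorially_finite C,
      forall X : modcat, C X <->
        (forall Y : modcat, C Y ->
           forall i : nat, (0 < i < n)%N -> ext_eq0 i X Y) &
      forall X : modcat, C X <->
        (forall Y : modcat, C Y ->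
           forall i : nat, (0 < i < n)%N -> ext_eq0 i Y X)].

Definition hom_eq0 (X Y : Kbcat) : Prop :=
  forall f : hom X Y, heq f (zero_map X Y).

Definition cluster_tilting (n : nat) (B : Kbcat -> Prop) : Prop :=
  [/\ subcategory B,
      functorially_finite B,
      forall X : Kbcat, B X <->
        (forall Y : Kbcat, B Y ->
           forall i : nat, (0 < i < n)%N -> hom_eq0 X (kbpr_shift Y i)) &
      forall X : Kbcat, B X <->
        (forall Y : Kbcat, B Y ->
           forall i : nat, (0 < i < n)%N -> hom_eq0 Y (kbpr_shift X i))].

(* C[nZ].  A module X is viewed in K^b(pr R) through the derived category, so
   X[ln] is any object of K^b(pr R) isomorphic there to the shifted stalk. *)
Definition shifts (n : nat) (C : modcat -> Prop) : Kbcat -> Prop :=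
  add (fun Q : Kbcat => exists (X : modcat) (l : int),
         C X /\ derived_iso Q (shift (stalk X) (l * n%:Z))).

End Modules.

(* Main.v *)
(** For objects A of K^b(pr Lambda) isomorphic to M[a] and B isomorphic to N[b],
    Hom(A, B[i]) is Ext of degree i + b - a.  It vanishes outside [0, n] since
    gl.dim <= n, and strictly between 0 and n when M and N lie in C, hence
    always when n divides a and b and 0 < i < n.

    Conversely, let Hom(C[nZ], X[i]) = 0, or Hom(X, C[nZ][i]) = 0, for 0 < i < n.
    Since the regular module and its dual lie in C, the cohomology of X is
    concentrated in degrees divisible by n.  As gl.dim <= n, a projective
    resolution of H^a(X) maps to X and realizes its cohomology in degree a, so X
    is the direct sum of shifts of these resolutions, and H^a(X) lies in C by
    maximality.

    Left approximations come from left C-approximations of the cokernels of the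
    differentials of X.  Right approximations are obtained from them by forming
    successively the cocones of T -> B[e], with T -> B[e] a left approximation
    and e = n - 1, ..., 1, starting with T = X: each step keeps the lifting
    property of T -> X and kills one more group Hom(T, C[nZ][e]). *)

Require Import Defs.
From mathcomp Require Import all_boot all_order all_algebra all_field.
From HB Require Import structures.
From mathcomp Require Import generic_quotient ring_quotient boolp.
From mathcomp Require Import zify.

Set Implicit Arguments.
Unset Strict Implicit.
Unset Printing Implicit Defensive.

Import Order.TTheory GRing.Theory Num.Theory.
Local Open Scope ring_scope.

(** * Submodules, quotients and duality *)

(** The statement mixes roofs through arbitrary complexes ([derived_iso]) with chain maps up to
    homotopy between perfect complexes. One principle reconciles them: maps from a bounded above
    complex of projectives to an exact complex are null. Applied to the cocone of a
    quasi-isomorphism, it gives lifts along that quasi-isomorphism, unique up to homotopy. The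
    regular module and its dual D lie in C because Ext^i(Lambda, -) and Ext^i(-, D) vanish for i >
    0. They detect cohomology: Hom(Lambda, X[j]) is H^j(X), and Hom(X, D[j]) is the k-dual of
    H^(-j)(X). The splitting of X rests on a count: a resolution of H^a(X) has length at most n, so
    extending its map to X can only meet an obstruction in H^(a-1)(X), ..., H^(a-n+1)(X), and these
    vanish. The next possible cohomology, H^(a-n)(X), is just out of reach. In the right
    approximations e decreases because the triangle B[e-1] -> T' -> T -> B[e] controls Hom(T',
    C[nZ][i]) for i >= e: there Hom(B[e-1], C[nZ][i]) has degree i - e + 1, between 1 and n - 1. *)

Section ProductMaps.
Variables (R : nzRingType) (U V W : lmodType R).

Definition proj_left : {linear (U * V)%type -> U} :=
  mklin ((fun _ _ _ => erefl) : linear (fst : U * V -> U)).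

Definition proj_right : {linear (U * V)%type -> V} :=
  mklin ((fun _ _ _ => erefl) : linear (snd : U * V -> V)).

Fact incl_left_linear : linear (fun u : U => (u, 0) : (U * V)%type).
Proof. by move=> a x y; congr pair; rewrite /= scaler0 addr0. Qed.

Definition incl_left : {linear U -> (U * V)%type} := mklin incl_left_linear.

Fact incl_right_linear : linear (fun v : V => (0, v) : (U * V)%type).
Proof. by move=> a x y; congr pair; rewrite /= scaler0 addr0. Qed.

Definition incl_right : {linear V -> (U * V)%type} := mklin incl_right_linear.

Definition pair_map (f : {linear W -> U}) (g : {linear W -> V}) (x : W) :
  (U * V)%type := (f x, g x).

Fact pair_map_linear (f : {linear W -> U}) (g : {linear W -> V}) :
  linear (pair_map f g).
Proof. by move=> a x y; rewrite /pair_map !linearP. Qed.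

End ProductMaps.

Definition is_submodule (R : nzRingType) (M : lmodType R) (S : M -> Prop) :=
  S 0 /\ forall a x y, S x -> S y -> S (a *: x + y).

Section SubQuotient.
Variables (R : nzRingType) (M : lmodType R) (S : M -> Prop).
Hypothesis S_sub : is_submodule S.

(** Submodules such as kernels and images are given by propositions; the classical truth value
    provides the boolean predicate on which subtypes and quotients are built. *)
Definition in_sub : {pred M} := fun x => `[< S x >].

Fact in_sub_closed : GRing.subsemimod_closed in_sub.
Proof.
have [S0 SP] := S_sub.
split; first split; first exact/asboolP.
  move=> x y /asboolP Sx /asboolP Sy; apply/asboolP.
  by rewrite -[x]scale1r; apply: SP.
move=> a x /asboolP Sx; apply/asboolP; rewrite -[_ *: _]addr0; exact: SP.
Qed.

Fact in_sub_zmod_closed : zmod_closed in_sub.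
Proof.
have [[h0 hD] hZ] := in_sub_closed.
by split=> // x y hx hy; rewrite -scaleN1r; apply: hD => //; apply: hZ.
Qed.

HB.instance Definition _ :=
  GRing.isZmodClosed.Build M in_sub in_sub_zmod_closed.

Definition sub_carrier := {x : M | in_sub x}.
HB.instance Definition _ := SubChoice.on sub_carrier.
HB.instance Definition _ :=
  GRing.SubChoice_isSubLmodule.Build R M in_sub sub_carrier in_sub_closed.

Lemma submoduleP : exists (N : lmodType R) (i : {linear N -> M}),
  injective i /\ forall x, S x <-> exists n, i n = x.
Proof.
exists sub_carrier, (val : {linear sub_carrier -> M}).
split; first exact: val_inj.
move=> x; split=> [Sx | [n <-]]; last exact/asboolP/(valP n).
have xS : in_sub x by apply/asboolP.
by exists (Sub x xS); exact: SubK.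
Qed.

Definition quo_carrier := (Quotient.quot in_sub).
HB.instance Definition _ := GRing.Zmodule.on quo_carrier.

Local Open Scope quotient_scope.
Definition quo_pi (x : M) : quo_carrier := \pi_((Quotient.quot in_sub)) x.
Definition quo_scale a (x : quo_carrier) : quo_carrier :=
  quo_pi (a *: repr (x : (Quotient.quot in_sub))).

Lemma quo_piP x y : quo_pi x = quo_pi y <-> S (x - y).
Proof.
have e : in_sub (x - y) = (quo_pi x == quo_pi y) := Quotient.idealrBE _ x y.
split=> [/eqP|/asboolP]; first by rewrite -e => /asboolP.
by rewrite -/(in_sub _) e => /eqP.
Qed.

Lemma quo_surj u : exists x, u = quo_pi x.
Proof. by exists (repr (u : (Quotient.quot in_sub))); rewrite /quo_pi reprK. Qed.

Lemma quo_piB x y : quo_pi (x - y) = quo_pi x - quo_pi y.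
Proof. by rewrite /quo_pi !piE. Qed.
Lemma quo_piD x y : quo_pi (x + y) = quo_pi x + quo_pi y.
Proof. by rewrite /quo_pi !piE. Qed.

Lemma quo_piZ a x : quo_scale a (quo_pi x) = quo_pi (a *: x).
Proof.
apply/quo_piP; rewrite -scalerBr -[_ *: _]addr0.
have [S0 SP] := S_sub; apply: SP S0.
by apply/quo_piP; rewrite /quo_pi reprK.
Qed.

Fact quo_scalerA a b v : quo_scale a (quo_scale b v) = quo_scale (a * b) v.
Proof. by have [x ->] := quo_surj v; rewrite !quo_piZ scalerA. Qed.
Fact quo_scale1r : left_id 1 quo_scale.
Proof. by move=> v; have [x ->] := quo_surj v; rewrite quo_piZ scale1r. Qed.
Fact quo_scalerDr : right_distributive quo_scale +%R.
Proof.
move=> a u v; have [x ->] := quo_surj u; have [y ->] := quo_surj v.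
by rewrite -quo_piD !quo_piZ scalerDr quo_piD.
Qed.
Fact quo_scalerDl v : {morph quo_scale^~ v : a b / a + b}.
Proof.
move=> a b; have [x ->] := quo_surj v.
by rewrite !quo_piZ scalerDl quo_piD.
Qed.

HB.instance Definition _ := GRing.Zmodule_isLmodule.Build R quo_carrier
  quo_scalerA quo_scale1r quo_scalerDr quo_scalerDl.

Lemma quotientP : exists (N : lmodType R) (p : {linear M -> N}),
  (forall u, exists x, p x = u) /\ forall x, p x = 0 <-> S x.
Proof.
have lin : linear (quo_pi : M -> quo_carrier).
  by move=> a x y; rewrite quo_piD -quo_piZ.
exists quo_carrier, (mklin lin); split=> [u|x] /=.
  by have [x ->] := quo_surj u; exists x.
have -> : 0 = quo_pi 0 by have := quo_piB 0 0; rewrite !subrr => ->.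
by rewrite quo_piP subr0.
Qed.

End SubQuotient.

Lemma linear_factor_mono (R : nzRingType) (M N L : lmodType R)
    (i : {linear N -> M}) (f : {linear L -> M}) :
  injective i -> (forall x, exists n, i n = f x) ->
  exists g : {linear L -> N}, forall x, i (g x) = f x.
Proof.
move=> inj_i /choice[g gP].
have lin : linear g.
  by move=> a x y; apply: inj_i; rewrite linearP !gP linearP.
by exists (mklin lin).
Qed.

Lemma linear_factor_epi (R : nzRingType) (M N L : lmodType R)
    (p : {linear M -> N}) (f : {linear M -> L}) :
  (forall u, exists x, p x = u) -> (forall x, p x = 0 -> f x = 0) ->
  exists g : {linear N -> L}, forall x, g (p x) = f x.
Proof.
move=> /choice[s sP] fker.
have fs x y : p x = p y -> f x = f y.
  by move=> e; apply/eqP; rewrite -subr_eq0 -linearB fker // linearB e subrr.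
have lin : linear (f \o s).
  by move=> a x y /=; rewrite -linearP; apply: fs; rewrite linearP !sP.
by exists (mklin lin) => x /=; apply: fs; rewrite sP.
Qed.

(** [projective] speaks of surjections, so g is first corestricted to its image, which contains the
    values of f. *)
Lemma projective_lift (R : nzRingType) (P M N : lmodType R^c)
    (g : {linear M -> N}) (f : {linear P -> N}) :
  projective P -> (forall x, exists m, g m = f x) ->
  exists h : {linear P -> M}, forall x, g (h x) = f x.
Proof.
move=> projP fim.
have im_sub : is_submodule (fun y => exists m, g m = y).
  split; first by exists 0; rewrite linear0.
  by move=> a _ _ [x <-] [y <-]; exists (a *: x + y); rewrite linearP.
have [K [i [inj_i iP]]] := submoduleP im_sub.
have [|g' g'P] := linear_factor_mono (f := g) inj_i.
  by move=> x; apply/iP; exists x.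
have [|f' f'P] := linear_factor_mono (f := f) inj_i.
  by move=> x; apply/iP.
have [|h hP] := projP _ _ g' f'; last by exists h => x; rewrite -g'P hP.
move=> y; have [m e] : exists m, g m = i y by apply/iP; exists y.
by exists m; apply: inj_i; rewrite g'P.
Qed.

(** Among the matrices whose row space lies in G, one of maximal rank works: adjoining a vector of G
    cannot raise the rank, so that vector was already in the row space. *)
Lemma row_space_submodule (k : fieldType) (p : nat) (G : 'rV[k]_p -> Prop) :
  is_submodule G -> exists A : 'M[k]_p, forall v, G v <-> (v <= A)%MS.
Proof.
move=> [G0 GP].
pose Q r := `[< exists A : 'M[k]_p,
                  (forall v : 'rV_p, (v <= A)%MS -> G v) /\ \rank A = r >].
have Q0 : exists r, Q r.
  exists 0%N; apply/asboolP; exists 0; split; last exact: mxrank0.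
  by move=> v; rewrite submx0 => /eqP ->.
have Qp r : Q r -> (r <= p)%N.
  by move=> /asboolP[A [_ <-]]; exact: rank_leq_row.
have [_ /asboolP[A [AG <-]] Amax] := ex_maxnP Q0 Qp.
exists A => v; split=> [Gv|]; last exact: AG.
have : Q (\rank (A + v)%MS).
  apply/asboolP; exists (A + v)%MS; split=> // w /sub_addsmxP[[a b] /= ->].
  have -> : a *m A + b *m v = b 0 0 *: v + a *m A.
    by rewrite addrC {1}[b]mx11_scalar mul_scalar_mx.
  by apply: GP => //; apply: AG; exact: submxMl.
move=> /Amax le_rank; have := mxrank_leqif_sup (addsmxSl A v).
move=> /geq_leqif; rewrite le_rank => /esym.
by apply: submx_trans; exact: addsmxSr.
Qed.

(** * Linear algebra over k: finite generation and the dual of the algebra *)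

Section FiniteDimension.
Variables (k : fieldType) (Lambda : falgType k).
Local Notation rmod := (lmodType Lambda^c).

(** A [Lambda^c]-module carries no k-structure of its own. Letting k act through the scalars of the
    algebra makes every module map k-linear for free. *)
Definition kact (M : rmod) (a : k) (x : M) : M := (a%:A : Lambda^c) *: x.

Lemma kactA (M : rmod) a b (x : M) : kact a (kact b x) = kact (a * b) x.
Proof.
rewrite /kact scalerA; congr (_ *: _).
by rewrite /GRing.mul /= mulr_algl scalerA mulrC.
Qed.

Lemma kact1 (M : rmod) (x : M) : kact 1 x = x.
Proof. by rewrite /kact scale1r; exact: scale1r. Qed.

Lemma kact0 (M : rmod) (x : M) : kact 0 x = 0.
Proof. by rewrite /kact scale0r; exact: scale0r. Qed.

Lemma kactDl (M : rmod) a b (x : M) : kact (a + b) x = kact a x + kact b x.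
Proof. by rewrite /kact scalerDl; exact: scalerDl. Qed.

Lemma kactDr (M : rmod) a (x y : M) : kact a (x + y) = kact a x + kact a y.
Proof. exact: scalerDr. Qed.

Lemma linear_kact (M N : rmod) (f : {linear M -> N}) a x :
  f (kact a x) = kact a (f x).
Proof. exact: linearZ. Qed.

Definition klin (M : rmod) (phi : M -> k) :=
  forall a x y, phi (kact a x + y) = a * phi x + phi y.

Definition kcomb (M : rmod) p (b : 'I_p -> M) (v : 'rV[k]_p) : M :=
  \sum_j kact (v 0 j) (b j).

Lemma kcombP (M : rmod) p (b : 'I_p -> M) a u v :
  kcomb b (a *: u + v) = kact a (kcomb b u) + kcomb b v.
Proof.
rewrite /kcomb {2}/kact scaler_sumr -big_split /=; apply: eq_bigr => j _.
by rewrite !mxE kactDl -kactA.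
Qed.

Lemma kcomb0 (M : rmod) p (b : 'I_p -> M) : kcomb b 0 = 0.
Proof.
by rewrite /kcomb big1 // => j _; rewrite mxE /kact scale0r; exact: scale0r.
Qed.

Lemma kcomb_mul (M : rmod) p q (b : 'I_p -> M) (u : 'rV[k]_q) (A : 'M_(q, p)) :
  kcomb b (u *m A) = \sum_i kact (u 0 i) (kcomb b (row i A)).
Proof.
rewrite mulmx_sum_row; elim/big_rec2: _ => [|i x y _ <-]; first exact: kcomb0.
by rewrite kcombP.
Qed.

Lemma fg_kspan (M : rmod) : finitely_generated M ->
  exists p (b : 'I_p -> M), forall x, exists v, x = kcomb b v.
Proof.
move=> [m [e eP]].
pose B := vbasis (fullv : {vspace Lambda}).
pose I := ('I_m * 'I_(\dim (fullv : {vspace Lambda})))%type.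
pose b (i : I) : M := (B`_i.2 : Lambda^c) *: e i.1.
exists #|{: I}|, (fun j => b (enum_val j)) => x.
have [c ->] := eP x.
exists (\row_j coord B (enum_val j).2 (c (enum_val j).1)).
rewrite /kcomb.
under [RHS]eq_bigr => j _ do rewrite mxE.
rewrite -(reindex (@enum_val I (mem {: I}))
  (P := xpredT) (F := fun i : I => kact (coord B i.2 (c i.1)) (b i))) /=;
  last first.
  by apply: onW_bij; exact: enum_val_bij.
rewrite -(pair_bigA _ (fun i j => kact (coord B j (c i)) (b (i, j)))) /=.
apply: eq_bigr => i _.
rewrite {1}[c i](coord_vbasis (memvf _)).
rewrite -/B /b /= /kact.
under [RHS]eq_bigr => j _ do rewrite scalerA.
rewrite -[RHS]scaler_suml; congr (_ *: _); apply: eq_bigr => j _.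
by rewrite /GRing.mul /= mulr_algr.
Qed.

Lemma kspan_fg (M : rmod) p (b : 'I_p -> M) :
  (forall x, exists v, x = kcomb b v) -> finitely_generated M.
Proof.
move=> bP; exists p, b => x; have [v ->] := bP x.
by exists (fun j => (v 0 j)%:A).
Qed.

(** The coordinate vectors of elements of the image of i form a subspace of k^p; preimages of the
    rows of a spanning matrix generate N. This makes cohomology modules finitely generated. *)
Lemma fg_submodule (M N : rmod) (i : {linear N -> M}) :
  finitely_generated M -> injective i -> finitely_generated N.
Proof.
move=> /fg_kspan[p [b bP]] inj_i.
have [|A AP] := @row_space_submodule k p (fun v => exists x, i x = kcomb b v).
  split; first by exists 0; rewrite linear0 kcomb0.
  move=> a u v [x ex] [y ey]; exists (kact a x + y).
  by rewrite kcombP -ex -ey /kact linearP.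
have /choice[c cP] : forall j, exists x, i x = kcomb b (row j A).
  by move=> j; apply/AP; exact: row_sub.
apply: (@kspan_fg _ p c) => x.
have [v ev] := bP (i x).
have /AP/submxP[u eu] : exists y, i y = kcomb b v by exists x.
exists u; apply: inj_i; rewrite ev eu kcomb_mul linear_sum.
by apply: eq_bigr => j _; rewrite -cP /kact linearZ.
Qed.

Lemma fg_quotient (M N : rmod) (p : {linear M -> N}) :
  finitely_generated M -> (forall u, exists x, p x = u) -> finitely_generated N.
Proof.
move=> [m [e eP]] psurj; exists m, (p \o e) => u.
have [x <-] := psurj u; have [c ->] := eP x; exists c.
by rewrite linear_sum; apply: eq_bigr => i _; rewrite linearZ.
Qed.

(* The unknown values of psi on a spanning family solve a linear system, which
   is consistent because G is single-valued at 0. *)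
Lemma functional_extension (N : rmod) (G : N -> k -> Prop) :
  finitely_generated N -> G 0 0 ->
  (forall a x y s t, G x s -> G y t -> G (kact a x + y) (a * s + t)) ->
  (forall t, G 0 t -> t = 0) ->
  exists psi : N -> k, klin psi /\ forall x t, G x t -> psi x = t.
Proof.
move=> /fg_kspan[p [b bP]] G0 GP Gfun.
(* The graph of G in coordinates: the first p entries describe x, the last one is the prescribed
   value. *)
pose H (w : 'rV[k]_(p + 1)) := G (kcomb b (lsubmx w)) (rsubmx w 0 0).
have [|A AP] := @row_space_submodule k (p + 1) H.
  rewrite /H; split; first by rewrite !linear0 kcomb0 mxE.
  move=> a u v hu hv; rewrite !linearP kcombP.
  by rewrite !mxE; rewrite !mxE in hu hv; apply: GP.
(* Solvability as a kernel condition: a row combination that kills the left block represents a pair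
   (0, t) of G, so it kills the right column as well. The entries of c are the values on the
   spanning family. *)
have [c cP] : exists c : 'cV_p, lsubmx A *m c = rsubmx A.
  have : ((rsubmx A)^T <= (lsubmx A)^T)%MS.
    rewrite submxE; apply/eqP/trmx_inj; rewrite trmx_mul trmxK trmx0.
    set K := (cokermx _)^T.
    have KL : K *m lsubmx A = 0.
      by apply: trmx_inj; rewrite trmx_mul trmxK mulmx_coker trmx0.
    apply/row_matrixP => i; rewrite row_mul row0.
    set u := row i K.
    have uL : u *m lsubmx A = 0 by rewrite -row_mul KL row0.
    have /AP : (u *m A <= A)%MS by exact: submxMl.
    rewrite /H -{1 2}[A]hsubmxK mul_mx_row row_mxKl row_mxKr uL kcomb0 => /Gfun e.
    by rewrite [LHS]mx11_scalar e; apply/rowP => j; rewrite !mxE mul0rn.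
  move=> /submxP[c ec]; exists c^T.
  by apply: trmx_inj; rewrite trmx_mul trmxK -ec.
have val x v t : G x t -> x = kcomb b v -> (v *m c) 0 0 = t.
  move=> Gx ex.
  have /AP/submxP[u eu] : H (row_mx v t%:M).
    by rewrite /H row_mxKl row_mxKr -ex mxE eqxx mulr1n.
  have : v *m c = u *m rsubmx A.
    rewrite -cP mulmxA; congr (_ *m _).
    by rewrite -[v](row_mxKl _ (t%:M)) eu -{1}[A]hsubmxK mul_mx_row row_mxKl.
  move=> ->; have -> : u *m rsubmx A = t%:M.
    by rewrite -[t%:M](row_mxKr v) eu -{2}[A]hsubmxK mul_mx_row row_mxKr.
  by rewrite mxE eqxx mulr1n.
have [s sP] := choice bP.
exists (fun x => (s x *m c) 0 0); split=> [a x y|x t Gx]; last exact: val Gx (sP x).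
(* The choice [s] of coordinates is not linear, but its defect represents 0, where [val] forces the
   value 0. *)
have ker0 : kcomb b (a *: s x + s y - s (kact a x + y)) = 0.
  rewrite addrC -scaleN1r kcombP kcombP -!sP /kact scaleNr scale1r scaleN1r.
  exact: addNr.
have /esym := val 0 _ 0 G0 (esym ker0).
rewrite mulmxBl mulmxDl -scalemxAl !mxE => /eqP.
by rewrite eq_sym subr_eq0 => /eqP ->.
Qed.

(** The alias inherits only the additive group of linear forms, leaving room for the right action in
    which f acted on by a is the form x |-> f(a x). *)
Definition dual_mod := 'Hom(Lambda, k^o).
HB.instance Definition _ := GRing.Zmodule.on dual_mod.

Fact dual_scale_linear (a : Lambda^c) (f : dual_mod) :
  linear (fun x : Lambda => f ((a : Lambda) * x)).
Proof. by move=> c x y; rewrite mulrDr -scalerAr linearP. Qed.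

Definition dual_scale a f : dual_mod := linfun (mklin (dual_scale_linear a f)).

Lemma dual_scaleE a f x : dual_scale a f x = f ((a : Lambda) * x).
Proof. by rewrite /dual_scale lfunE. Qed.

Fact dual_scalerA a b v :
  dual_scale a (dual_scale b v) = dual_scale (a * b) v.
Proof. by apply/lfunP => x; rewrite !dual_scaleE mulrA. Qed.
Fact dual_scale1r : left_id 1 dual_scale.
Proof. by move=> v; apply/lfunP => x; rewrite !dual_scaleE mul1r. Qed.
Fact dual_scalerDr : right_distributive dual_scale +%R.
Proof.
by move=> a u v; apply/lfunP => x; rewrite dual_scaleE !add_lfunE !dual_scaleE.
Qed.
Fact dual_scalerDl v : {morph dual_scale^~ v : a b / a + b}.
Proof.
move=> a b; apply/lfunP => x.
by rewrite add_lfunE !dual_scaleE mulrDl linearD.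
Qed.

HB.instance Definition _ := GRing.Zmodule_isLmodule.Build Lambda^c dual_mod
  dual_scalerA dual_scale1r dual_scalerDr dual_scalerDl.

(* The universal property of the right module Hom_k(Lambda, k), with ev the
   evaluation at 1. *)
Definition is_dual (D : rmod) (ev : D -> k) :=
  [/\ klin ev,
      forall (M : rmod) (phi : M -> k), klin phi ->
        exists f : {linear M -> D}, forall x, ev (f x) = phi x &
      forall (M : rmod) (f g : {linear M -> D}),
        (forall x, ev (f x) = ev (g x)) -> forall x, f x = g x].

Lemma dual_module_exists : exists (D : rmod) (ev : D -> k),
  finitely_generated D /\ is_dual ev.
Proof.
have scaleE (a : Lambda^c) (f : dual_mod) x :
  (a *: f) x = f ((a : Lambda) * x) := dual_scaleE a f x.
have kactE (a : k) (f : dual_mod) x : kact a f x = a * f x.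
  by rewrite scaleE mulr_algl linearZ.
exists dual_mod, (fun f : dual_mod => f 1 : k); split.
  pose B := vbasis (fullv : {vspace 'Hom(Lambda, k^o)}).
  apply: (@kspan_fg dual_mod _ (fun j => B`_j)) => f.
  exists (\row_j coord B j f).
  rewrite {1}[f](coord_vbasis (memvf _)); apply: eq_bigr => j _.
  by apply/lfunP => x; rewrite kactE mxE scale_lfunE.
split.
- by move=> a f g; rewrite add_lfunE kactE.
(* The map sends x to the form a |-> phi(x a), whose value at 1 is phi(x). *)
- move=> M phi phiP.
  have lin x : linear (fun a : Lambda => phi ((a : Lambda^c) *: x) : k^o).
    move=> c a b; rewrite scalerDl -phiP /kact; congr (phi (_ + _)).
    by rewrite scalerA; congr (_ *: _); rewrite /GRing.mul /= mulr_algr.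
  have flin : linear (fun x : M => linfun (mklin (lin x)) : dual_mod).
    move=> b x y; apply/lfunP => a.
    rewrite add_lfunE scaleE !lfunE /= scalerDr scalerA.
    have := phiP 1 (((b : Lambda) * a : Lambda^c) *: x) ((a : Lambda^c) *: y).
    by rewrite /kact !scale1r mul1r.
  exists (mklin flin) => x; apply: etrans (lfunE (mklin (lin x)) 1) _.
  by rewrite /= scale1r.
- move=> M f g efg x; apply/lfunP => a.
  by have := efg ((a : Lambda^c) *: x); rewrite !linearZ /= !scaleE mulr1.
Qed.

End FiniteDimension.

(** * Maps of arbitrary degree between complexes *)

Section GradedMaps.
Variable R : nzRingType.
Local Notation rmod := (lmodType R^c).
Implicit Types (X Y Z W : complex R) (e d : int).

Definition sgn e : R^c := (-1) ^+ odd `|e|%N.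

Lemma sgn_odd e d : odd `|e|%N = odd `|d|%N -> sgn e = sgn d.
Proof. by rewrite /sgn => ->. Qed.

Lemma sgnD e d : sgn (e + d) = sgn e * sgn d.
Proof. by rewrite /sgn -signr_addb; congr (_ ^+ nat_of_bool _); lia. Qed.

Lemma sgnN e : sgn (- e) = sgn e.
Proof. by rewrite /sgn abszN. Qed.

Lemma sgn_cases e : sgn e = 1 \/ sgn e = -1.
Proof. by rewrite /sgn; case: odd; [right | left]. Qed.

Lemma sgnMM e : sgn e * sgn e = 1.
Proof. by case: (sgn_cases e) => ->; rewrite ?mulrNN mulr1. Qed.

Lemma sgn1 : sgn 1 = -1.
Proof. by []. Qed.

Lemma sgnK e (M : rmod) (x : M) : sgn e *: (sgn e *: x) = x.
Proof. by rewrite scalerA sgnMM scale1r. Qed.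

Lemma sgn_inj e (M : rmod) (x y : M) : sgn e *: x = sgn e *: y -> x = y.
Proof. by move=> /(congr1 (fun z => sgn e *: z)); rewrite !sgnK. Qed.

Lemma linear_sgn e (U V : rmod) (f : {linear U -> V}) x :
  f (sgn e *: x) = sgn e *: f x.
Proof. exact: linearZ. Qed.

(** Over a noncommutative ring a scalar multiple of a linear map need not be linear. The case split
    avoids the issue and has the form of the differential of [shift]. *)
Definition slin e (U V : rmod) (f : {linear U -> V}) : {linear U -> V} :=
  if odd `|e|%N then \- f : {linear U -> V} else f.

Lemma slinE e (U V : rmod) (f : {linear U -> V}) x : slin e f x = sgn e *: f x.
Proof. by rewrite /slin /sgn; case: odd; rewrite /= ?expr1 ?scaleN1r ?scale1r. Qed.

(* A map of degree e from X to Y is a family indexed by all pairs of degrees,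
   of which only the components with j = i + e are meaningful; this avoids
   transports between the terms of the complexes. *)
Definition gmap X Y := forall i j, {linear X i -> Y j}.

(** A cycle of the Hom complex, that is, a chain map X -> Y[e]. The degrees are variables
    constrained by equations, so that any provably equal expressions can be substituted. *)
Definition cyc X Y e (f : gmap X Y) := forall i j i' j',
  j = i + e -> i' = i + 1 -> j' = j + 1 ->
  forall x, f i' j' (diff X i i' x) = sgn e *: diff Y j j' (f i j x).

(** The homotopy relation in the single source degree i, so that homotopies can be built one degree
    at a time. *)
Definition htpy X Y e (f h : gmap X Y) i := forall j i' j',
  j = i + e -> i' = i + 1 -> j' = j - 1 ->
  forall x, f i j x = sgn e *: diff Y j' j (h i j' x) + h i' j (diff X i i' x).

Definition null X Y e (f : gmap X Y) := exists h, forall i, htpy e f h i.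

(** Vanishing of Hom(X, Y[e]) in the homotopy category, without forming the shift. *)
Definition hom0 e X Y := forall f : gmap X Y, cyc e f -> null e f.

Definition exact X i := forall x : X i, diff X i (i + 1) x = 0 ->
  exists y, x = diff X (i - 1) i y.

Definition gmap0 X Y : gmap X Y := fun i j => \0.

Definition gsub X Y (f g : gmap X Y) : gmap X Y := fun i j => f i j \- g i j.

Definition gcomp X Y Z e (f : gmap Y Z) (g : gmap X Y) : gmap X Z :=
  fun i j => f (i + e) j \o g i (i + e).

(** Explicit casts along equalities of degrees are confined to this lemma, the next two and
    [unshiftl]; they disappear because equality proofs between integers are unique. *)
Lemma family_extension (X Y : int -> rmod) (s : int -> int)
    (f : forall i, {linear X i -> Y (s i)}) :
  exists g : forall i j, {linear X i -> Y j}, forall i, g i (s i) = f i.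
Proof.
exists (fun i j => match s i =P j with
  | ReflectT e => ecast j {linear X i -> Y j} e (f i)
  | ReflectF _ => \0 end) => i.
by case: eqP => // e; rewrite [e]eq_axiomK.
Qed.

Lemma family_shift (X Y : int -> rmod) e
    (h : forall i j, {linear X i -> Y (j + e)}) :
  exists g : forall i j, {linear X i -> Y j}, forall i j, g i (j + e) = h i j.
Proof.
exists (fun i j => ecast j {linear X i -> Y j} (subrK e j) (h i (j - e))).
move=> i j; move: (subrK _ _); rewrite addrK => p.
by rewrite [p]eq_axiomK.
Qed.

Lemma family_update (X Y : int -> rmod) (h : forall i j, {linear X i -> Y j})
    i0 j0 (g : {linear X i0 -> Y j0}) :
  exists h' : forall i j, {linear X i -> Y j},
    h' i0 j0 = g /\ forall i j, (i != i0) || (j != j0) -> h' i j = h i j.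
Proof.
exists (fun i j => match i0 =P i, j0 =P j with
  | ReflectT a, ReflectT b =>
    ecast i {linear X i -> Y j} a (ecast j {linear X i0 -> Y j} b g)
  | _, _ => h i j end); split.
  by case: eqP => // a; case: eqP => // b; rewrite [a]eq_axiomK [b]eq_axiomK.
move=> i j ne; case: eqP => [a|//]; case: eqP => [b|//].
by exfalso; move: ne; rewrite a b !eqxx.
Qed.

Lemma identity_gmap X : exists f : gmap X X, forall i, f i i = idfun.
Proof.
by have [f fP] := family_extension (fun i => idfun : {linear X i -> X i}); exists f.
Qed.

Lemma cyc_id X (f : gmap X X) : (forall i, f i i = idfun) -> cyc 0 f.
Proof.
by move=> fE i j i' j'; rewrite addr0 => -> -> -> x; rewrite !fE scale1r.
Qed.

Lemma cyc_comp X Y Z e d (f : gmap Y Z) (g : gmap X Y) :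
  cyc d f -> cyc e g -> cyc (e + d) (gcomp e f g).
Proof.
move=> fC gC i j i' j' -> -> -> x; rewrite /gcomp /=.
have e1 : i + 1 + e = i + e + 1 by lia.
rewrite (gC i (i + e) (i + 1) (i + 1 + e) erefl erefl e1) linear_sgn.
rewrite e1 (fC (i + e) (i + (e + d)) _ (i + (e + d) + 1) _ erefl erefl); last by lia.
by rewrite scalerA sgnD.
Qed.

Lemma null_compl X Y Z e d (f : gmap Y Z) (g : gmap X Y) :
  cyc d f -> null e g -> null (e + d) (gcomp e f g).
Proof.
move=> fC [h hP].
have [k kP] := family_extension
  (fun i => f (i + e - 1) (i + e - 1 + d) \o h i (i + e - 1)).
exists k => i j i' j' -> -> -> x; rewrite /gcomp /=.
have -> : i + (e + d) - 1 = i + e - 1 + d by lia.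
rewrite (hP i (i + e) (i + 1) (i + e - 1)) // linearD linear_sgn.
rewrite (fC (i + e - 1) (i + e - 1 + d)) //; try lia.
rewrite scalerA -sgnD kP /=; congr (_ + _).
have -> : i + (e + d) = i + 1 + e - 1 + d by lia.
by rewrite kP /=; have -> : i + 1 + e - 1 = i + e by lia.
Qed.

Lemma null_compr X Y Z e d (f : gmap Y Z) (g : gmap X Y) :
  cyc e g -> null d f -> null (e + d) (gcomp e f g).
Proof.
move=> gC [h hP].
have [k kP] := family_extension (fun i =>
  slin e (h (i + e) (i + e + d - 1) \o g i (i + e))).
exists k => i j i' j' -> -> -> x; rewrite /gcomp /=.
have -> : i + (e + d) - 1 = i + e + d - 1 by lia.
rewrite (hP (i + e) (i + (e + d)) (i + e + 1) (i + e + d - 1)) ?addrA //.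
rewrite kP slinE /= linear_sgn scalerA sgnD -mulrA (_ : sgn d * _ = sgn e * sgn d).
  rewrite mulrA sgnMM mul1r; congr (_ + _).
  have e1 : i + e + d = i + 1 + e + d - 1 by lia.
  rewrite -[i + e + d]/(i + e + d) e1 kP slinE /= -e1.
  rewrite (gC i (i + e) (i + 1) (i + 1 + e)) //; last by lia.
  rewrite linear_sgn sgnK.
  by have -> : i + e + 1 = i + 1 + e by lia.
by rewrite -!sgnD addrC.
Qed.

Lemma cyc_sub X Y e (f g : gmap X Y) : cyc e f -> cyc e g -> cyc e (gsub f g).
Proof.
move=> fC gC i j i' j' ej ei' ej' x /=.
by rewrite (fC _ _ _ _ ej ei' ej') (gC _ _ _ _ ej ei' ej') linearB scalerBr.
Qed.

Lemma null_sub X Y e (f g : gmap X Y) : null e f -> null e g -> null e (gsub f g).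
Proof.
move=> [h hP] [k kP]; exists (gsub h k) => i j i' j' ej ei' ej' x /=.
rewrite (hP _ _ _ _ ej ei' ej') (kP _ _ _ _ ej ei' ej').
by rewrite linearB scalerBr opprD addrACA.
Qed.

Lemma null_eq X Y e (f g : gmap X Y) :
  (forall i x, f i (i + e) x = g i (i + e) x) -> null e f -> null e g.
Proof.
move=> fg [h hP]; exists h => i j i' j' ej ei' ej' x.
by rewrite -(hP _ _ _ _ ej ei' ej') ej fg.
Qed.

Lemma null0 X Y e (f : gmap X Y) : (forall i x, f i (i + e) x = 0) -> null e f.
Proof.
move=> f0; exists (@gmap0 X Y) => i j i' j' -> _ _ x.
by rewrite f0 /= linear0 scaler0 addr0.
Qed.

Lemma null_trans X Y e (f g h : gmap X Y) :
  null e (gsub f g) -> null e (gsub g h) -> null e (gsub f h).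
Proof.
move=> fg gh; have n0 : null e (gsub g g) by apply: null0 => i x; rewrite /= subrr.
apply: null_eq (null_sub fg (null_sub n0 gh)) => i x /=.
by rewrite subrr sub0r opprK addrA subrK.
Qed.

Lemma null_sym X Y e (f g : gmap X Y) : null e (gsub f g) -> null e (gsub g f).
Proof.
move=> fg; have n0 : null e (gsub g g) by apply: null0 => i x; rewrite /= subrr.
by apply: null_eq (null_sub n0 fg) => i x /=; rewrite subrr sub0r opprB.
Qed.

Lemma null_of_sub X Y e (f g : gmap X Y) : null e (gsub f g) -> null e g -> null e f.
Proof.
move=> fg [h hP]; have n0 : null e (@gmap0 X Y) by apply: null0.
apply: null_eq (null_sub fg (null_sub n0 (ex_intro _ h hP))) => i x /=.
by rewrite sub0r opprK subrK.
Qed.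

End GradedMaps.

(** * Lifting along quasi-isomorphisms *)

Section Lifting.
Variable R : nzRingType.
Local Notation rmod := (lmodType R^c).
Implicit Types (P X Y Z W A B : complex R) (e d : int).

Definition projectives X := forall i, projective (X i).
Definition bounded_above X := exists N : int, forall i, N < i -> is_zero (X i).

(** The defect [phi], which is f - h d, takes values in cycles because the homotopy relation holds
    one degree higher. Exactness turns these into boundaries, and projectivity lifts [phi] through
    the differential. *)
Lemma homotopy_step X Y e (f h : gmap X Y) i :
  projective (X i) -> cyc e f -> htpy e f h (i + 1) ->
  is_zero (X i) \/ exact Y (i + e) ->
  exists h' : gmap X Y,
    htpy e f h' i /\ forall i' j, i' != i -> h' i' j = h i' j.
Proof.
move=> projX fC hP [X0|exY].
  exists h; split=> // j i' j' _ _ _ x.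
  by rewrite [x]X0 !linear0 scaler0 addr0.
pose phi : {linear X i -> Y (i + e)} :=
  f i (i + e) \- (h (i + 1) (i + e) \o diff X i (i + 1)).
have [|psi psiP] := @projective_lift _ _ _ _ (diff Y (i + e - 1) (i + e)) phi projX.
  move=> x; have [|y ->] := exY (phi x); last by exists y.
  rewrite /phi /= linearB.
  have := fC i _ _ _ erefl erefl erefl x.
  rewrite (hP (i + e + 1) (i + 1 + 1) (i + e)) ?diff2 ?linear0 ?addr0 //; try lia.
  rewrite addrAC => /(congr1 (fun y => sgn R e *: y)).
  by rewrite !sgnK => ->; rewrite subrr.
have [h' [h'i h'P]] := family_update h (slin e psi : {linear X i -> Y (i + e - 1)}).
exists h'; split=> [j i' j' -> -> -> x | i' j ne]; last by rewrite h'P ?ne.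
rewrite h'i slinE linear_sgn sgnK psiP h'P ?subrK //.
by rewrite -subr_eq0 addrAC subrr.
Qed.

(* Descending recursion on degrees; the final homotopy is the diagonal of the
   sequence of partial ones. *)
Lemma extend_homotopy X Y e (f h : gmap X Y) (m : int) :
  projectives X -> cyc e f -> (forall i, m <= i -> htpy e f h i) ->
  (forall i, i < m -> is_zero (X i) \/ exact Y (i + e)) ->
  exists h' : gmap X Y,
    (forall i, htpy e f h' i) /\ forall i j, m <= i -> h' i j = h i j.
Proof.
move=> projX fC hP exY.
pose ok (N : nat) (g : gmap X Y) := forall i, m - N%:Z <= i -> htpy e f g i.
pose agree (N : nat) (g g' : gmap X Y) :=
  forall i j, m - N%:Z <= i -> g' i j = g i j.
(* Stated as an implication for every pair, so that choice gives a total step function to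
   iterate. *)
have step (p : nat * gmap X Y) :
  exists g', ok p.1 p.2 -> ok p.1.+1 g' /\ agree p.1 p.2 g'.
  case: p => N g /=; have [okg|nok] := pselect (ok N g); last by exists g => /nok.
  have [||g' [g'P g'E]] := @homotopy_step X Y e f g (m - N.+1%:Z) (projX _) fC.
  - by apply: okg; lia.
  - by apply: exY; lia.
  exists g' => _; split; last by move=> i j hi; apply: g'E; apply/eqP; lia.
  move=> i hi; have [->|ne] := eqVneq i (m - N.+1%:Z); first exact: g'P.
  have hi' : m - N%:Z <= i by move/eqP: ne; lia.
  move=> j i' j' ej ei' ej' x; rewrite !g'E; try by apply/eqP; lia.
  exact: okg.
have [F FP] := choice step.
pose s := fix s N := if N is N'.+1 then F (N', s N') else h.
have s_ok N : ok N (s N).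
  elim: N => [|N IH]; first by move=> i hi; apply: hP; lia.
  by have [] := FP (N, s N) IH.
have s_agree N k : agree N (s N) (s (N + k)%N).
  elim: k => [|k IH]; first by rewrite addn0.
  move=> i j hi; rewrite addnS /=.
  have [_ ag] := FP ((N + k)%N, s (N + k)%N) (s_ok _).
  have hi2 : m - (N + k)%N%:Z <= i by lia.
  exact: etrans (ag _ _ hi2) (IH _ _ hi).
(* The number of steps after which the components in source degree i are final. *)
pose depth (i : int) : nat := if m <= i then 0%N else `|m - i|%N.
exists (fun i j => s (depth i) i j); split; last by move=> i j hi; rewrite /depth hi.
move=> i j i' j' ej ei' ej' x.
have hi : m - (depth i)%:Z <= i by rewrite /depth; case: ifP; lia.
rewrite (s_ok _ _ hi _ _ _ ej ei' ej'); congr (_ + _).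
have -> : depth i = (depth i' + (depth i - depth i'))%N.
  by rewrite /depth; do 2![case: ifP]; lia.
by rewrite s_agree // /depth; case: ifP; lia.
Qed.

(** The recursion starts above the bound of P, where every map is zero. Applied to cocones of
    quasi-isomorphisms, this is the source of all liftings below. *)
Lemma hom0_exact P A e : projectives P -> bounded_above P ->
  (forall i, is_zero (P i) \/ exact A (i + e)) -> hom0 e P A.
Proof.
move=> projP [N NP] exA f fC.
have [||h [hP _]] := @extend_homotopy P A e f (@gmap0 _ P A) (N + 1) projP fC.
- move=> i hi j i' j' _ _ _ x; have -> : x = 0 by apply: NP; lia.
  by rewrite !linear0 scaler0 addr0.
- by move=> i _; exact: exA.
by exists h.
Qed.

(** * Cocones of maps of arbitrary degree *)

Section Cocone.
Variables (X Y : complex R) (e : int) (u : gmap X Y).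
Hypothesis uC : cyc e u.

(** The third term T of a triangle Y[e-1] -> T -> X -> Y[e]; this is why the second component of the
    differential carries the sign of Y[e-1]. *)
Definition cocone_term i : rmod := (X i * Y (i + (e - 1))%R)%type.

(** Cut off outside j = i + 1, since the other components of u are arbitrary while a differential
    must vanish there. *)
Definition cocone_link i j : {linear X i -> Y (j + (e - 1))} :=
  if j == i + 1 then u i (j + (e - 1)) else \0.

Definition cocone_fun i j (p : cocone_term i) : cocone_term j :=
  (diff X i j p.1,
   cocone_link i j p.1 + sgn R (e + 1) *: diff Y (i + (e - 1)) (j + (e - 1)) p.2).

Fact cocone_fun_linear i j : linear (@cocone_fun i j).
Proof.
move=> a x y; rewrite /cocone_fun -[RHS]/(_ , _) /= !linearP; congr pair.
have [->|->] := sgn_cases R (e + 1); rewrite ?scale1r ?scaleN1r.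
  by rewrite scalerDr addrACA.
by rewrite scalerDr scalerN opprD addrACA.
Qed.

Fact cocone_deg i j : j != i + 1 -> forall p, @cocone_fun i j p = 0.
Proof.
move=> ne p; rewrite /cocone_fun /cocone_link (negPf ne) diff_deg //.
rewrite diff_deg /= ?scaler0 ?addr0 //.
by apply: contraNneq ne; lia.
Qed.

Fact cocone_diff2 i j l p : @cocone_fun j l (@cocone_fun i j p) = 0.
Proof.
have lin0 a b : @cocone_fun a b 0 = 0 := linear0 (mklin (@cocone_fun_linear a b)).
have [-> | ne] := eqVneq j (i + 1); last by rewrite (cocone_deg ne) lin0.
have [-> | ne] := eqVneq l (i + 1 + 1); last by rewrite (cocone_deg ne).
rewrite /cocone_fun /cocone_link /= !eqxx diff2; congr pair.
rewrite linearD linear_sgn diff2 scaler0 addr0.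
rewrite (uC (i := i) (j := i + 1 + (e - 1))) //; try lia.
by rewrite sgnD sgn1 mulrN1 scaleNr subrr.
Qed.

Definition cocone : complex R := @Complex R cocone_term
  (fun i j => mklin (@cocone_fun_linear i j)) cocone_deg cocone_diff2.

Lemma cocone_diffE i j t b : diff cocone i j (t, b) =
  (diff X i j t,
   cocone_link i j t + sgn R (e + 1) *: diff Y (i + (e - 1)) (j + (e - 1)) b).
Proof. by []. Qed.

Definition to_cocone Z (f : gmap Z X) (g : gmap Z Y) : gmap Z cocone :=
  fun i j => mklin (pair_map_linear (f i j) (g i (j + (e - 1)))).

Lemma to_coconeE Z (f : gmap Z X) (g : gmap Z Y) i j x :
  to_cocone f g i j x = (f i j x, g i (j + (e - 1)) x).
Proof. by []. Qed.

Lemma to_cocone_surj Z (h : gmap Z cocone) :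
  exists f g, forall i j x, h i j x = to_cocone f g i j x.
Proof.
have [g gP] := family_shift (fun i j => proj_right _ _ \o h i j).
exists (fun i j => proj_left _ _ \o h i j), g => i j x.
by rewrite to_coconeE gP /=; case: (h i j x).
Qed.

(** A chain map to the cocone amounts to a chain map f to X together with a null-homotopy, up to
    sign, of its composite with u. *)
Lemma to_cocone_cyc Z c (f : gmap Z X) (g : gmap Z Y) : cyc c f ->
  (forall i x, g (i + 1) (i + c + e) (diff Z i (i + 1) x) =
    sgn R c *: (u (i + c) (i + c + e) (f i (i + c) x) +
      sgn R (e + 1) *: diff Y (i + c + e - 1) (i + c + e) (g i (i + c + e - 1) x))) ->
  cyc c (to_cocone f g).
Proof.
move=> fC gE i j i' j' -> -> -> x.
rewrite !to_coconeE cocone_diffE /cocone_link eqxx.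
rewrite (fC i (i + c) (i + 1) (i + c + 1)) //.
rewrite -[RHS]/(_, _); congr pair; rewrite /=.
have -> : i + c + 1 + (e - 1) = i + c + e by lia.
have -> : i + c + (e - 1) = i + c + e - 1 by lia.
by rewrite gE.
Qed.

Lemma to_cocone_null Z c (f : gmap Z X) (g : gmap Z Y) : null c (to_cocone f g) ->
  exists (h : gmap Z X) (k : gmap Z Y), (forall i, htpy c f h i) /\
    forall i x, g i (i + c + e - 1) x =
      sgn R c *: (u (i + c - 1) (i + c + e - 1) (h i (i + c - 1) x) +
        sgn R (e + 1) *: diff Y (i + c + e - 2) (i + c + e - 1) (k i (i + c + e - 2) x))
      + k (i + 1) (i + c + e - 1) (diff Z i (i + 1) x).
Proof.
move=> [H HP]; have [h [k hkP]] := to_cocone_surj H.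
exists h, k; split=> [i j i' j' ej ei' ej' x | i x].
  by have := HP i j i' j' ej ei' ej' x; rewrite !hkP !to_coconeE cocone_diffE => -[].
have := HP i _ _ _ erefl erefl erefl x.
rewrite !hkP !to_coconeE cocone_diffE /cocone_link subrK eqxx => -[_].
have -> : i + c + (e - 1) = i + c + e - 1 by lia.
by have -> : i + c - 1 + (e - 1) = i + c + e - 2 by lia.
Qed.

End Cocone.

(** Bijectivity from H^i to H^j. It is kept pointwise because the partial decompositions of a
    complex are controlled only in selected degrees. *)
Definition qis_at Y W (q : gmap Y W) i j :=
  (forall y : Y i, diff Y i (i + 1) y = 0 ->
     (exists w, q i j y = diff W (j - 1) j w) ->
     exists y', y = diff Y (i - 1) i y') /\
  (forall w : W j, diff W j (j + 1) w = 0 ->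
     exists y w', diff Y i (i + 1) y = 0 /\ w = q i j y + diff W (j - 1) j w').

Definition qis Y W d (q : gmap Y W) := forall i j, j = i + d -> qis_at q i j.

(** The long exact sequence by hand: a cocycle (y, w) makes q y a boundary, so injectivity gives y =
    d y0; then w - q y0 is a cocycle, and surjectivity supplies the correction z to y0. *)
Lemma cocone_exact Y W d (q : gmap Y W) (qC : cyc d q) :
  qis d q -> forall i, exact (cocone qC) i.
Proof.
move=> qQ i [y w]; rewrite cocone_diffE /cocone_link eqxx => -[dy].
have [qinj _] := qQ i (i + 1 + (d - 1)) ltac:(lia).
rewrite sgnD sgn1 mulrN1 scaleNr => /eqP; rewrite subr_eq0 => /eqP qy.
have [|y0 ey] := qinj y dy.
  have -> : i + 1 + (d - 1) - 1 = i + (d - 1) by lia.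
  by exists (sgn R d *: w); rewrite linear_sgn -qy.
have [_] := qQ (i - 1) (i + (d - 1)) ltac:(lia).
have -> : i + (d - 1) - 1 = i - 1 + (d - 1) by lia.
move=> qsur; have [|z [w' [dz ew]]] := qsur (w - q (i - 1) (i + (d - 1)) y0).
  rewrite linearB; apply/eqP; rewrite subr_eq0; apply/eqP.
  have e1 : i + (d - 1) + 1 = i + 1 + (d - 1) by lia.
  rewrite e1; apply: (@sgn_inj _ d); rewrite -qy ey.
  by rewrite (qC _ (i + (d - 1))) //; lia.
rewrite subrK in dz.
exists (y0 + z, sgn R (d + 1) *: w').
rewrite cocone_diffE /cocone_link subrK eqxx linear_sgn sgnK !linearD dz addr0.
by rewrite -ey -addrA -ew addrC subrK.
Qed.

Section Lift.
Variables (P Y W : complex R) (d e : int) (q : gmap Y W).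
Hypotheses (projP : projectives P) (bddP : bounded_above P).
Hypotheses (qC : cyc d q) (qQ : qis d q).

Lemma hom0_cocone a : hom0 a P (cocone qC).
Proof. by apply: hom0_exact => // i; right; exact: cocone_exact. Qed.

(** The pair (0, f) is a chain map to the cocone of q, hence null. The first component of a
    null-homotopy is the lift up to sign, the second a homotopy from f to q g. *)
Lemma lift_qis (f : gmap P W) : cyc (e + d) f ->
  exists g : gmap P Y, cyc e g /\ null (e + d) (gsub f (gcomp e q g)).
Proof.
move=> fC.
have FC : cyc (e + 1) (to_cocone qC (@gmap0 _ P Y) f).
  apply: to_cocone_cyc => [i j i' j' _ _ _ x | i x]; first by rewrite !linear0 scaler0.
  rewrite /= linear0 add0r scalerA.
  have -> : i + (e + 1) + d - 1 = i + (e + d) by lia.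
  rewrite (fC i (i + (e + d)) (i + 1)) //; last by lia.
  by congr (_ *: _); rewrite -sgnD; apply: sgn_odd; lia.
have [g [k [gP kP]]] := to_cocone_null (hom0_cocone FC).
exists (fun i j => slin (e + 1) (g i j)); split=> [i j i' j' -> -> -> x|].
  rewrite !slinE linear_sgn; have := gP i (i + e + 1) _ _ ltac:(lia) erefl erefl x.
  rewrite addrK => /esym/eqP; rewrite addr_eq0 => /eqP ->.
  by rewrite sgnD sgn1 mulrN1 scaleNr scalerN.
exists k => i j i' j' -> -> -> x; rewrite /= /gcomp /= slinE linear_sgn.
have := kP i x; have -> : i + (e + 1) + d - 1 = i + (e + d) by lia.
have -> : i + (e + 1) + d - 2 = i + (e + d) - 1 by lia.
have -> : i + (e + 1) - 1 = i + e by lia.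
move=> ->; rewrite scalerDr -[X in X - _]addrA addrAC subrr add0r scalerA -sgnD.
by rewrite (@sgn_odd R _ (e + d)) //; lia.
Qed.

(** With a null-homotopy k of q g, the pair (g, k) is, up to sign, a chain map to the exact cocone;
    the first component of its null-homotopy serves g. *)
Lemma lift_qis_null (g : gmap P Y) :
  cyc e g -> null (e + d) (gcomp e q g) -> null e g.
Proof.
move=> gC [k kP].
have FC : cyc e (to_cocone qC g (fun i j => slin e (k i j))).
  apply: to_cocone_cyc => // i x; rewrite !slinE linear_sgn.
  have := kP i (i + e + d) _ _ ltac:(lia) erefl erefl x; rewrite /gcomp /= => ->.
  congr (_ *: _).
rewrite scalerA [RHS]addrAC.
rewrite -scalerDl -sgnD.
  rewrite (@sgn_odd R (d + 1 + e) (e + d + 1)); last by lia.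
  by rewrite [sgn R (e + d + 1)]sgnD sgn1 mulrN1 subrr scale0r add0r.
by have [h [_ [hP _]]] := to_cocone_null (hom0_cocone FC); exists h.
Qed.

End Lift.

End Lifting.

(** * Calculus of quasi-isomorphisms *)

Section QuasiIsomorphisms.
Variable R : nzRingType.
Local Notation rmod := (lmodType R^c).
Implicit Types (P Q X Y Z W : complex R) (e d : int).

Lemma gcomp_subr X Y Z e (f : gmap Y Z) (g g' : gmap X Y) i j x :
  gcomp e f (gsub g g') i j x = gsub (gcomp e f g) (gcomp e f g') i j x.
Proof. by rewrite /gcomp /= linearB. Qed.

Lemma gcomp_null_subl X Y Z e d (f f' : gmap Y Z) (g : gmap X Y) : cyc e g ->
  null d (gsub f f') -> null (e + d) (gsub (gcomp e f g) (gcomp e f' g)).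
Proof. by move=> gC ff'; apply: null_eq (null_compr gC ff') => i x. Qed.

Lemma gcomp_null_subr X Y Z e d (f : gmap Y Z) (g g' : gmap X Y) : cyc d f ->
  null e (gsub g g') -> null (e + d) (gsub (gcomp e f g) (gcomp e f g')).
Proof.
move=> fC gg'; apply: null_eq (null_compl fC gg') => i x.
exact: gcomp_subr.
Qed.

Lemma cyc_pred X Y e (f : gmap X Y) i j x : cyc e f -> j = i + e ->
  f i j (diff X (i - 1) i x) = sgn R e *: diff Y (j - 1) j (f (i - 1) (j - 1) x).
Proof. by move=> fC ej; rewrite (fC (i - 1) (j - 1)) //; lia. Qed.

Lemma qis_comp X Y Z e d (f : gmap Y Z) (g : gmap X Y) :
  cyc d f -> qis d f -> cyc e g -> qis e g -> qis (e + d) (gcomp e f g).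
Proof.
move=> fC fQ gC gQ i j ->; rewrite addrA /gcomp /=.
have [ginj gsur] := gQ i (i + e) erefl.
have [finj fsur] := fQ (i + e) (i + e + d) erefl.
split=> [x dx [w ew] | w dw].
  apply: ginj => //; apply: finj; last by exists w.
  apply: (@sgn_inj _ e); by rewrite -(gC i (i + e) (i + 1)) ?dx ?linear0 ?scaler0.
have [y [w' [dy ->]]] := fsur w dw; have [x [y' [dx ->]]] := gsur y dy.
exists x, (sgn R d *: f (i + e - 1) (i + e + d - 1) y' + w'); split=> //.
by rewrite linearD -[LHS]addrA linearD linear_sgn (cyc_pred _ fC).
Qed.

Lemma qis_cancel X Y Z e d (f : gmap Y Z) (g : gmap X Y) :
  cyc d f -> qis d f -> cyc e g -> qis (e + d) (gcomp e f g) -> qis e g.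
Proof.
move=> fC fQ gC fgQ i j ->.
have [finj fsur] := fQ (i + e) (i + e + d) erefl.
have [fginj fgsur] := fgQ i (i + e + d) ltac:(lia).
rewrite /gcomp /= in fginj fgsur.
split=> [x dx [w ew] | y dy].
  apply: fginj => //; exists (sgn R d *: f (i + e - 1) (i + e + d - 1) w).
  by rewrite linear_sgn ew (cyc_pred _ fC).
have [|x [w' [dx ew]]] := fgsur (f (i + e) (i + e + d) y).
  apply: (@sgn_inj _ d).
  by rewrite -(fC (i + e) (i + e + d) (i + e + 1)) // dy linear0 scaler0.
have [||y' ey'] := finj (y - g i (i + e) x).
- rewrite linearB dy sub0r; apply/eqP; rewrite oppr_eq0; apply/eqP.
  apply: (@sgn_inj _ e); rewrite -(gC i (i + e) (i + 1)) //.
  by rewrite dx linear0 scaler0.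
- by exists w'; rewrite linearB ew [LHS]addrAC subrr add0r.
by exists x, y'; split=> //; rewrite -ey' [RHS]addrC subrK.
Qed.

Lemma qis_homotopic X Y e (f g : gmap X Y) :
  null e (gsub f g) -> qis e f -> qis e g.
Proof.
move=> [h hP] fQ i j ej; have [finj fsur] := fQ i j ej.
have fg x : diff X i (i + 1) x = 0 ->
    f i j x = g i j x + diff Y (j - 1) j (sgn R e *: h i (j - 1) x).
  move=> dx; have := hP i j (i + 1) (j - 1) ej erefl erefl x.
  by rewrite dx linear0 addr0 /= linear_sgn => <-; rewrite [RHS]addrC subrK.
split=> [x dx [w ew] | w dw].
  apply: finj => //; exists (w + sgn R e *: h i (j - 1) x).
  by rewrite fg // ew linearD.
have [x [w' [dx ->]]] := fsur w dw.
by exists x, (sgn R e *: h i (j - 1) x + w'); split=> //; rewrite fg // linearD addrA.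
Qed.

Lemma qis_id X (f : gmap X X) : (forall i, f i i = idfun) -> qis 0 f.
Proof.
move=> fE i j; rewrite addr0 => ->; rewrite /qis_at fE /=; split=> [x _ [w ->]|x dx].
  by exists w.
by exists x, 0; rewrite linear0 addr0.
Qed.

Lemma hom0_target P Y W e d (q : gmap Y W) :
  projectives P -> bounded_above P -> cyc d q -> qis d q ->
  hom0 e P Y <-> hom0 (e + d) P W.
Proof.
move=> projP bddP qC qQ; split=> [PY f fC | PW g gC].
  have [g [gC fg]] := lift_qis projP bddP qC qQ fC.
  by apply: null_of_sub fg _; apply: null_compl => //; exact: PY.
apply: (lift_qis_null projP bddP qC qQ) => //; apply: PW; exact: cyc_comp.
Qed.

(** The comparison theorem for resolutions: lift q along p and p along q. The composite on Q is the
    one that lets [hom0_source] carry vanishing from P to Q. *)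
Lemma qis_inverse P Q W a b (p : gmap P W) (q : gmap Q W) :
  projectives P -> bounded_above P -> projectives Q -> bounded_above Q ->
  cyc b p -> qis b p -> cyc a q -> qis a q ->
  exists (g : gmap Q P) (g' : gmap P Q),
    [/\ cyc (a - b) g, cyc (b - a) g' &
        forall u : gmap Q Q, (forall i, u i i = idfun) ->
        null 0 (gsub (gcomp (a - b) g' g) u)].
Proof.
move=> projP bddP projQ bddQ pC pQ qC qQ.
have [|g [gC gP]] := @lift_qis _ Q P W b (a - b) p projQ bddQ pC pQ q.
  by rewrite subrK.
have [|g' [gC' gP']] := @lift_qis _ P Q W a (b - a) q projP bddP qC qQ p.
  by rewrite subrK.
rewrite subrK in gP; rewrite subrK in gP'.
exists g, g'; split=> // u uE; have uC := cyc_id uE.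
have ggC : cyc 0 (gcomp (a - b) g' g).
  by have := cyc_comp gC' gC; rewrite addrA subrK subrr.
apply: (lift_qis_null projQ bddQ qC qQ) => //; first exact: cyc_sub.
rewrite add0r.
have n1 : null a (gsub (gcomp (a - b) p g) (gcomp (a - b) (gcomp (b - a) q g') g)).
  by have := gcomp_null_subl gC gP'; rewrite subrK.
apply: null_eq (null_sym (null_trans gP n1)) => i x.
rewrite /gcomp /gsub /= addr0 linearB uE.
by have -> : i + (a - b) + (b - a) = i by lia.
Qed.

End QuasiIsomorphisms.

(** * Shifts, sums and stalk complexes *)

Section Translation.
Variable R : nzRingType.
Local Notation rmod := (lmodType R^c).
Implicit Types (P Q X Y Z W : complex R) (M N : rmod) (e d : int).

Lemma shiftE X l i j x :
  diff (shift X l) i j x = sgn R l *: diff X (i + l) (j + l) x.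
Proof. exact: slinE. Qed.

Lemma hom0_shiftr e b X Y : hom0 e X (shift Y b) <-> hom0 (e + b) X Y.
Proof.
split=> H f fC.
  have [|h hP] := H (fun i j => f i (j + b)).
    move=> i j i' j' -> -> -> x; rewrite shiftE scalerA -sgnD.
    by rewrite (fC i (i + e + b)) //; lia.
  have [k kP] := family_shift h; exists k => i j i' j' -> -> -> x.
  have := hP i (i + e) _ _ erefl erefl erefl x.
  rewrite shiftE scalerA -sgnD -!kP /=.
  have -> : i + e - 1 + b = i + (e + b) - 1 by lia.
  by rewrite -[i + e + b]addrA.
have [f' f'P] := family_shift f.
have [|h hP] := H f'.
  move=> i j i' j' -> -> -> x.
  have := fC i (i + e) _ _ erefl erefl erefl x.
  rewrite shiftE scalerA -sgnD -!f'P /=.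
  have -> : i + e + 1 + b = i + (e + b) + 1 by lia.
  by rewrite -[i + e + b]addrA.
exists (fun i j => h i (j + b)) => i j i' j' -> -> -> x.
rewrite -f'P shiftE scalerA -sgnD.
by rewrite (hP i _ (i + 1) (i + e - 1 + b)) //; lia.
Qed.

Definition gshiftl a X Y (f : gmap X Y) : gmap (shift X a) Y :=
  fun i j => f (i + a) j.

Lemma cyc_shiftl a e X Y (f : gmap X Y) : cyc e f -> cyc (e + a) (gshiftl a f).
Proof.
move=> fC i j i' j' -> -> -> x; rewrite shiftE linear_sgn /gshiftl.
rewrite (fC (i + a) (i + (e + a)) _ (i + (e + a) + 1)) //; try lia.
by rewrite scalerA -sgnD [a + e]addrC.
Qed.

Lemma qis_at_shiftl a X Y (f : gmap X Y) i j :
  qis_at f (i + a) j -> qis_at (gshiftl a f) i j.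
Proof.
move=> [finj fsur].
rewrite /gshiftl; split=> [x | w dw].
  rewrite shiftE => /(congr1 (fun y => sgn R a *: y)); rewrite sgnK scaler0 /=.
  rewrite [i + 1 + a]addrAC => dx w; have [y ->] := finj x dx w.
  move: y; have -> : i + a - 1 = i - 1 + a by lia.
  by move=> y; exists (sgn R a *: y); rewrite shiftE linear_sgn sgnK.
have [x [w' [dx ->]]] := fsur w dw; exists x, w'; split=> //.
by rewrite shiftE /= [i + 1 + a]addrAC dx scaler0.
Qed.

Lemma qis_shiftl a e X Y (f : gmap X Y) : qis e f -> qis (e + a) (gshiftl a f).
Proof. by move=> fQ i j ej; apply/qis_at_shiftl/fQ; lia. Qed.

Lemma unshiftl a X Y (f : gmap (shift X a) Y) :
  exists g : gmap X Y, forall i j x, g (i + a) j x = f i j x.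
Proof.
exists (fun i j => ecast i {linear X i -> Y j} (subrK a i) (f (i - a) j)).
move=> i j x; move: (subrK _ _); rewrite addrK => p.
by rewrite [p]eq_axiomK.
Qed.

Lemma hom0_shiftl e a X Y : hom0 e (shift X a) Y <-> hom0 (e - a) X Y.
Proof.
split=> H f fC.
  have [|h hP] := H (gshiftl a f).
    by have := @cyc_shiftl a _ _ _ _ fC; rewrite subrK.
  have [k kP] := unshiftl (fun i j => slin a (h i j) : {linear _ -> _}).
  exists k => i j i' j' -> -> -> x.
  move: x; rewrite -(subrK a i); move: (i - a) => {}i x.
  have := hP i (i + e) _ _ erefl erefl erefl x.
  rewrite shiftE linear_sgn /gshiftl.
  have -> : i + a + (e - a) = i + e by lia.
  have -> : i + a + 1 = i + 1 + a by lia.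
  move=> ->; rewrite !kP !slinE linear_sgn; congr (_ + _).
  rewrite scalerA -sgnD; congr (_ *: _); apply: sgn_odd; lia.
have [g gP] := unshiftl f.
have [|h hP] := H g.
  move=> i j i' j' -> -> -> x.
  move: x; rewrite -(subrK a i); move: (i - a) => {}i x.
  have := fC i (i + e) _ _ erefl erefl erefl x.
  rewrite shiftE linear_sgn -!gP.
  have -> : i + a + (e - a) = i + e by lia.
  have -> : i + a + 1 = i + 1 + a by lia.
  move=> /(congr1 (fun y => sgn R a *: y)); rewrite sgnK => ->.
  rewrite scalerA -sgnD; congr (_ *: _); apply: sgn_odd; lia.
exists (fun i j => slin a (h (i + a) j) : {linear _ -> _}).
move=> i j i' j' -> -> -> x.
rewrite -gP (hP (i + a) (i + e) (i + 1 + a) (i + e - 1)) //; try lia.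
rewrite !slinE.
rewrite !linear_sgn sgnK scalerA -sgnD; congr (_ *: _ + _).
by apply: sgn_odd; lia.
Qed.

(** The bridge between the morphisms of [Kbcat] and the graded maps with which the proof
    computes. *)
Definition represents X Y (F : chain_map X Y) (f : gmap X Y) :=
  cyc 0 f /\ forall i x, F i x = f i i x.

Lemma gmap_of_chain_map X Y (F : chain_map X Y) : exists f, represents F f.
Proof.
have [f fP] := family_extension (fun i => F i); exists f.
split=> [i j i' j' | i x]; last by rewrite fP.
by rewrite addr0 => -> -> -> x; rewrite !fP cmP scale1r.
Qed.

Lemma chain_map_of_gmap X Y (f : gmap X Y) : cyc 0 f ->
  exists F : chain_map X Y, represents F f.
Proof.
move=> fC.
have h i j x : f j j (diff X i j x) = diff Y i j (f i i x).
  have [-> | ne] := eqVneq j (i + 1); last by rewrite !diff_deg // linear0.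
  by rewrite (fC i i (i + 1) (i + 1)) ?addr0 // scale1r.
by exists (ChainMap h).
Qed.

Lemma homotopic_null X Y (F G : chain_map X Y) f g :
  represents F f -> represents G g -> homotopic F G <-> null 0 (gsub f g).
Proof.
move=> [_ Ff] [_ Gg]; split=> -[h hP]; exists h.
  move=> i j i' j'; rewrite addr0 => -> -> -> x.
  by rewrite /= -Ff -Gg hP scale1r.
move=> i x; rewrite Ff Gg.
by have := hP i i _ _ (esym (addr0 i)) erefl erefl x; rewrite scale1r.
Qed.

Lemma hom_eq0P X Y e :
  (forall F : chain_map X (shift Y e), homotopic F (zero_map X (shift Y e))) <->
  hom0 e X Y.
Proof.
have zR : represents (zero_map X (shift Y e)) (@gmap0 _ X (shift Y e)).
  by split=> // i j i' j' _ _ _ x; rewrite /= linear0 scaler0.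
rewrite -[e in hom0 e]add0r -hom0_shiftr; split=> [H f fC | H F].
  have [F Ff] := chain_map_of_gmap fC.
  apply: null_of_sub ((homotopic_null Ff zR).1 (H F)) _.
  exact: null0.
have [f Ff] := gmap_of_chain_map F.
apply/(homotopic_null Ff zR); apply: null_sub; last exact: null0.
by apply: H; case: Ff.
Qed.

Lemma quasi_isoP X Y (F : chain_map X Y) f :
  represents F f -> quasi_iso F <-> qis 0 f.
Proof.
move=> [_ Ff]; split=> H i; last first.
  have [inj sur] := H i i (esym (addr0 i)); split.
    by move=> x dx [y]; rewrite Ff => ey; apply: inj => //; exists y.
  by move=> y dy; have [x [y' [dx ->]]] := sur y dy; exists x, y'; rewrite Ff.
move=> j; rewrite addr0 => ->; have [inj sur] := H i; split.
  by move=> x dx [y]; rewrite -Ff => ey; apply: inj => //; exists y.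
by move=> y dy; have [x [y' [dx ->]]] := sur y dy; exists x, y'; rewrite Ff.
Qed.

Definition gid X : gmap X X := sval (cid (identity_gmap X)).

Lemma gidE X i : gid X i i = idfun.
Proof. exact: (svalP (cid (identity_gmap X))). Qed.

Lemma represents_id X : represents (id_map X) (gid X).
Proof.
split; last by move=> i x; rewrite gidE.
exact/cyc_id/gidE.
Qed.

Lemma represents_comp X Y Z (G : chain_map Y Z) (F : chain_map X Y) g f :
  represents G g -> represents F f -> represents (comp_map G F) (gcomp 0 g f).
Proof.
move=> [gC Gg] [fC Ff]; split; first by have := cyc_comp gC fC; rewrite addr0.
by move=> i x; rewrite /= Ff Gg /gcomp /= addr0.
Qed.

(** Isomorphic objects and direct summands are both retracts up to homotopy, so one notion serves
    two closure rules of [add]. *)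
Definition retract X Y := exists (i : gmap X Y) (r : gmap Y X),
  [/\ cyc 0 i, cyc 0 r & null 0 (gsub (gcomp 0 r i) (gid X))].

Lemma hom0_retractl e X Y Z : retract X Y -> hom0 e Y Z -> hom0 e X Z.
Proof.
move=> [i [r [iC rC ri]]] H f fC.
have n1 : null e (gcomp 0 f r) by apply: H; have := cyc_comp fC rC; rewrite add0r.
have n2 : null e (gcomp 0 (gcomp 0 f r) i).
  by have := null_compr iC n1; rewrite add0r.
have n3 := gcomp_null_subr fC ri; rewrite add0r in n3.
have := null_sub n2 n3; apply: null_eq => j x.
rewrite /gsub /= /gcomp /= !addr0 gidE /=.
by rewrite opprB [LHS]addrC subrK.
Qed.

Lemma hom0_retractr e X Y Z : retract X Y -> hom0 e Z Y -> hom0 e Z X.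
Proof.
move=> [i [r [iC rC ri]]] H f fC.
have n1 : null e (gcomp e i f) by apply: H; have := cyc_comp iC fC; rewrite addr0.
have n2 : null e (gcomp e r (gcomp e i f)).
  by have := null_compl rC n1; rewrite addr0.
have n3 := gcomp_null_subl fC ri; rewrite addr0 in n3.
have := null_sub n2 n3; apply: null_eq => j x.
by rewrite /gsub /= /gcomp /= !addr0 gidE /= opprB [LHS]addrC subrK.
Qed.

Lemma hom0_sumr e X Y Z :
  hom0 e X Y -> hom0 e X Z -> hom0 e X (complex_sum Y Z).
Proof.
move=> HY HZ f fC.
have [|h hP] := HY (fun i j => proj_left _ _ \o f i j).
  by move=> i j i' j' ej ei' ej' x /=; rewrite (fC i j i' j').
have [|k kP] := HZ (fun i j => proj_right _ _ \o f i j).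
  by move=> i j i' j' ej ei' ej' x /=; rewrite (fC i j i' j').
exists (fun i j => mklin (pair_map_linear (h i j) (k i j))).
move=> i j i' j' ej ei' ej' x.
have := hP i j i' j' ej ei' ej' x; have := kP i j i' j' ej ei' ej' x.
by rewrite /=; case: (f i j x) => y z /= -> ->.
Qed.

Lemma hom0_suml e X Y Z :
  hom0 e X Z -> hom0 e Y Z -> hom0 e (complex_sum X Y) Z.
Proof.
move=> HX HY f fC.
have [|h hP] := HX (fun i j => f i j \o incl_left _ _).
  move=> i j i' j' ej ei' ej' x /=; rewrite -(fC i j i' j') //=.
  by rewrite /prod_fun /= linear0.
have [|k kP] := HY (fun i j => f i j \o incl_right _ _).
  move=> i j i' j' ej ei' ej' x /=; rewrite -(fC i j i' j') //=.
  by rewrite /prod_fun /= linear0.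
have lin i j : linear (fun p : complex_sum X Y i => h i j p.1 + k i j p.2).
  by move=> a p q; rewrite /= !linearP scalerDr addrACA.
exists (fun i j => mklin (lin i j)) => i j i' j' ej ei' ej' [x y].
have -> : (x, y) = (x, 0) + (0, y) :> complex_sum X Y i.
  by congr pair; rewrite /= ?addr0 ?add0r.
rewrite linearD; have /= -> := hP i j i' j' ej ei' ej' x.
have /= -> := kP i j i' j' ej ei' ej' y.
rewrite /prod_fun /= !addr0 !add0r linearD scalerDr addrACA; congr (_ + _).
Qed.

Lemma stalk_zero N j : j != 0 -> is_zero (stalk N j).
Proof. by case: j => [[|m]|m] //= _; exact: rmod0_is_zero. Qed.

Lemma cyc_stalk e P N (f : {linear P (- e) -> N}) :
  (forall x, f (diff P (- e - 1) (- e) x) = 0) ->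
  exists F : gmap P (stalk N), cyc e F /\ F (- e) 0 = f.
Proof.
move=> fC; have [F [F0 FE]] :=
  family_update (@gmap0 _ P (stalk N)) (f : {linear P (- e) -> stalk N 0}).
exists F; split=> // i j i' j' -> -> -> x; rewrite scaler0.
have [e0 | ne] := eqVneq (i + e + 1) 0; last exact: (stalk_zero ne).
have ei : i = - e - 1 by lia.
move: x; rewrite e0 ei subrK => x; rewrite F0; exact: fC.
Qed.

(** A stalk has one nonzero term, so a map of degree e is its component at -e and a homotopy its
    component at -e + 1. The right-hand side is the formula of [ext_eq0]. *)
Lemma hom0_stalk e P N : hom0 e P (stalk N) <->
  forall f : {linear P (- e) -> N},
    (forall x, f (diff P (- e - 1) (- e) x) = 0) ->
    exists g : {linear P (- e + 1) -> N},
      forall x, f x = g (diff P (- e) (- e + 1) x).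
Proof.
split=> H f fC.
  have [F [FC F0]] := cyc_stalk fC; have [h hP] := H F FC.
  exists (h (- e + 1) 0 : {linear P (- e + 1) -> N}) => x.
  have := hP (- e) 0 _ _ ltac:(lia) erefl erefl x.
  by rewrite F0 scaler0 add0r.
have [|g gP] := H (f (- e) 0 : {linear P (- e) -> N}).
  move=> x; have := fC (- e - 1) (- 1) _ 0 ltac:(lia) erefl erefl x.
  by rewrite subrK scaler0.
have [h [h0 hE]] := family_update (@gmap0 _ P (stalk N))
  (g : {linear P (- e + 1) -> stalk N 0}).
exists h => i j i' j' -> -> -> x.
have [e0 | ne] := eqVneq (i + e) 0; last first.
  by rewrite [LHS](stalk_zero ne) [RHS](stalk_zero ne).
have ei : i = - e by lia.
move: x; rewrite e0 ei => x; rewrite scaler0 add0r h0; exact: gP.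
Qed.

End Translation.

(** * Shifted modules as perfect complexes *)

Section Placed.
Variable R : nzRingType.
Local Notation rmod := (lmodType R^c).
Implicit Types (P Q X Y Z W : complex R) (M N : rmod) (e d l : int).

(** Q is isomorphic to M[l] in the derived category, witnessed by a single quasi-isomorphism of
    degree l instead of a roof. *)
Definition placed Q M l := exists q : gmap Q (stalk M), cyc l q /\ qis l q.

Lemma cyc_shiftr b e X Y (f : gmap X Y) :
  cyc (e + b) f -> cyc e (fun i j => f i (j + b) : {linear X i -> shift Y b j}).
Proof.
move=> fC i j i' j' -> -> -> x; rewrite shiftE scalerA -sgnD.
by rewrite (fC i (i + e + b)) //; lia.
Qed.

Lemma qis_shiftr b e X Y (f : gmap X Y) :
  qis (e + b) f -> qis e (fun i j => f i (j + b) : {linear X i -> shift Y b j}).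
Proof.
move=> fQ i j ej; have [finj fsur] := fQ i (j + b) ltac:(lia).
have ej1 : j - 1 + b = j + b - 1 by lia.
have ej2 : j + 1 + b = j + b + 1 by lia.
split=> [x dx [w] | w].
  rewrite shiftE => ew; apply: finj => //.
  move: w ew; rewrite /= ej1 => w ->; exists (sgn R b *: w).
  by rewrite linear_sgn.
rewrite shiftE /= ej2 => /(congr1 (fun y => sgn R b *: y)).
rewrite sgnK scaler0 => dw; have [x [w' [dx ->]]] := fsur w dw.
exists x; move: w'; rewrite -ej1 => w'; exists (sgn R b *: w'); split=> //.
by rewrite shiftE linear_sgn sgnK.
Qed.

Lemma unshiftr b e X Y (f : gmap X (shift Y b)) : cyc e f -> qis e f ->
  exists g : gmap X Y, cyc (e + b) g /\ qis (e + b) g.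
Proof.
move=> fC fQ; have [g gP] := family_shift f; exists g; split.
  move=> i j i' j' -> -> -> x.
  have := fC i (i + e) _ _ erefl erefl erefl x.
  rewrite shiftE scalerA -sgnD -!gP /=.
  have -> : i + e + 1 + b = i + (e + b) + 1 by lia.
  by rewrite -[i + e + b]addrA.
move=> i j ->; have [finj fsur] := fQ i (i + e) erefl.
have ej1 : i + e - 1 + b = i + (e + b) - 1 by lia.
have ej2 : i + e + 1 + b = i + (e + b) + 1 by lia.
split=> [x dx [w ew] | w dw].
  apply: finj => //; move: w ew; rewrite -ej1 addrA => w ew.
  exists (sgn R b *: (w : shift Y b (i + e - 1))).
  by rewrite shiftE linear_sgn sgnK -gP.
move: w dw; rewrite -ej1 -ej2 addrA => w dw.
have [|x [w' [dx ew]]] := fsur w; first by rewrite shiftE dw scaler0.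
exists x, (sgn R b *: (w' : Y (i + e - 1 + b))); split=> //.
by rewrite ew -gP shiftE linear_sgn.
Qed.

Lemma placed_shift Q M l a : placed Q M l -> placed (shift Q a) M (l + a).
Proof.
move=> [q [qC qQ]]; exists (gshiftl a q).
by split; [exact: cyc_shiftl | exact: qis_shiftl].
Qed.

(** Lifting the identity of Q along the left leg of a roof splits that leg; composing with the right
    leg leaves one quasi-isomorphism out of Q. *)
Lemma derived_isoP Q M l : projectives Q -> bounded_above Q ->
  derived_iso Q (shift (stalk M) l) <-> placed Q M l.
Proof.
move=> projQ bddQ; split=> [[Z [s [f [sQ fQ]]]] | [q [qC qQ]]]; last first.
  have q'C := @cyc_shiftr l 0 _ _ q; rewrite add0r in q'C.
  have [F Ff] := chain_map_of_gmap (q'C qC).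
  exists Q, (id_map Q), F; split.
    by apply/(quasi_isoP (represents_id Q)); apply: qis_id; exact: gidE.
  by apply/(quasi_isoP Ff); apply: qis_shiftr; rewrite add0r.
have [s' ss'] := gmap_of_chain_map s; have [f' ff'] := gmap_of_chain_map f.
have s'Q := (quasi_isoP ss').1 sQ; have f'Q := (quasi_isoP ff').1 fQ.
have [s'C _] := ss'; have [f'C _] := ff'.
have [|g [gC gP]] := @lift_qis _ Q Z Q 0 0 s' projQ bddQ s'C s'Q (gid Q).
  by rewrite addr0; exact/cyc_id/gidE.
have gQ : qis 0 g.
  apply: (qis_cancel s'C s'Q gC); apply: qis_homotopic gP _.
  by rewrite addr0; apply: qis_id; exact: gidE.
have [h [hC hQ]] := unshiftr (cyc_comp f'C gC) (qis_comp f'C f'Q gC gQ).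
by exists h; rewrite !add0r in hC hQ.
Qed.

Lemma hom0_source P Q W a b e Z (p : gmap P W) (q : gmap Q W) :
  projectives P -> bounded_above P -> projectives Q -> bounded_above Q ->
  cyc b p -> qis b p -> cyc a q -> qis a q ->
  hom0 e P Z -> hom0 (e + (a - b)) Q Z.
Proof.
move=> projP bddP projQ bddQ pC pQ qC qQ H f fC.
have [g [g' [gC g'C gg]]] := qis_inverse projP bddP projQ bddQ pC pQ qC qQ.
have n1 : null e (gcomp (b - a) f g').
  apply: H; have := cyc_comp fC g'C.
  by have -> : b - a + (e + (a - b)) = e by lia.
have := null_compr gC n1; rewrite [a - b + e]addrC => n2.
have n3 := gcomp_null_subr fC (gg (gid Q) (@gidE _ Q)); rewrite add0r in n3.
have := null_sub n2 n3; apply: null_eq => j x.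
rewrite /gsub /= /gcomp /= !addr0 gidE /=.
have -> : j + (a - b) + (b - a) = j by lia.
by rewrite opprB [LHS]addrC subrK.
Qed.

Lemma retract_sum_left X Y : retract X (complex_sum X Y).
Proof.
exists (fun i j => incl_left _ _ \o gid X i j).
exists (fun i j => gid X i j \o proj_left _ _).
have gC := cyc_id (@gidE _ X).
split=> [i j i' j' ej ei' ej' x | i j i' j' ej ei' ej' x |].
- rewrite /= (gC i j i' j') // /prod_fun /= linear0 !scale1r; congr pair.
- by rewrite /= /prod_fun /= (gC i j i' j').
by apply: null0 => i x; rewrite /gsub /= /gcomp /= !addr0 !gidE /= subrr.
Qed.

Lemma retract_sum_right X Y : retract Y (complex_sum X Y).
Proof.
exists (fun i j => incl_right _ _ \o gid Y i j).
exists (fun i j => gid Y i j \o proj_right _ _).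
have gC := cyc_id (@gidE _ Y).
split=> [i j i' j' ej ei' ej' x | i j i' j' ej ei' ej' x |].
- rewrite /= (gC i j i' j') // /prod_fun /= linear0 !scale1r; congr pair.
- by rewrite /= /prod_fun /= (gC i j i' j').
by apply: null0 => i x; rewrite /gsub /= /gcomp /= !addr0 !gidE /= subrr.
Qed.

Lemma kbpr_projectives (X : kbpr R) : projectives X.
Proof. by move=> i; have [] := kbpr_pr X i. Qed.

Lemma kbpr_bounded_above (X : kbpr R) : bounded_above X.
Proof.
by have [N NP] := kbpr_bounded X; exists N%:Z => i hi; apply: NP; lia.
Qed.

Arguments kbpr_projectives X : clear implicits.
Arguments kbpr_bounded_above X : clear implicits.

Lemma iso_retract (X Y : kbpr R) : @iso (Kbcat R) X Y -> retract Y X.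
Proof.
move=> [F [G [_ FG]]].
have [f Ff] := gmap_of_chain_map F; have [g Gg] := gmap_of_chain_map G.
exists g, f; split; [by case: Gg | by case: Ff |].
exact/(homotopic_null (represents_comp Ff Gg) (represents_id Y)).
Qed.

(** Lifting the identity of Y gives g with q g homotopic to it. Then q g q and q are homotopic, and
    cancelling q shows that g is also a left inverse. *)
Lemma qis_iso (X Y : kbpr R) (q : gmap X Y) :
  cyc 0 q -> qis 0 q -> @iso (Kbcat R) X Y.
Proof.
move=> qC qQ; have gC Z : cyc 0 (gid Z) := cyc_id (@gidE _ Z).
have [|g [g0C qg]] := @lift_qis _ Y X Y 0 0 q (kbpr_projectives Y) (kbpr_bounded_above Y)
  qC qQ (gid Y); first by rewrite addr0.
rewrite addr0 in qg.
have gqC : cyc 0 (gcomp 0 g q) by have := cyc_comp g0C qC; rewrite addr0.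
have gq : null 0 (gsub (gcomp 0 g q) (gid X)).
  apply: (lift_qis_null (kbpr_projectives X) (kbpr_bounded_above X) qC qQ).
    exact: cyc_sub.
  have n1 := gcomp_null_subl qC (null_sym qg).
  apply: null_eq n1 => i x.
  by rewrite /gsub /= /gcomp /= !addr0 !gidE /= linearB.
have [Q Qq] := chain_map_of_gmap qC; have [G Gg] := chain_map_of_gmap g0C.
exists Q, G; split.
  exact/(homotopic_null (represents_comp Gg Qq) (represents_id X)).
apply/(homotopic_null (represents_comp Qq Gg) (represents_id Y)).
exact: null_sym.
Qed.

Lemma add_hom0l (S : Kbcat R -> Prop) e Z :
  (forall X : Kbcat R, S X -> hom0 e (X : kbpr R) Z) ->
  forall X : Kbcat R, Defs.add S X -> hom0 e (X : kbpr R) Z.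
Proof.
move=> H X; elim=> {X} [X /H // | | X Y XY _ | X Y _ HX _ HY | X Y _].
- by move=> f _; apply: null0 => i x; rewrite [x]rmod0_is_zero linear0.
- exact/hom0_retractl/iso_retract.
- exact: hom0_suml.
- exact/hom0_retractl/retract_sum_left.
Qed.

Lemma add_hom0r (S : Kbcat R -> Prop) e Z :
  (forall X : Kbcat R, S X -> hom0 e Z (X : kbpr R)) ->
  forall X : Kbcat R, Defs.add S X -> hom0 e Z (X : kbpr R).
Proof.
move=> H X; elim=> {X} [X /H // | | X Y XY _ | X Y _ HX _ HY | X Y _].
- by move=> f _; apply: null0 => i x; exact: rmod0_is_zero.
- exact/hom0_retractr/iso_retract.
- exact: hom0_sumr.
- exact/hom0_retractr/retract_sum_left.
Qed.

Lemma proj_resolution_placed P M : proj_resolution P M ->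
  [/\ projectives P, bounded_above P & placed P M 0].
Proof.
move=> [prP P0 [F FQ]]; split; first by move=> i; case: (prP i).
  by exists 0 => i; exact: P0.
have [f Ff] := gmap_of_chain_map F; exists f; split; first by case: Ff.
exact/(quasi_isoP Ff).
Qed.

Definition short_resolution (n : nat) M (P : kbpr R) :=
  [/\ placed P M 0, forall i : int, 0 < i -> is_zero (P i) &
      forall i : int, i < - n%:Z -> is_zero (P i)].

Lemma placed_resolution_shift n M (P : kbpr R) a :
  short_resolution n M P -> placed (kbpr_shift P a) M a.
Proof. by case=> /(placed_shift a) + _ _; rewrite add0r. Qed.

Lemma short_resolution_exists n (M : fgmod R) :
  gldim_le R n -> exists P : kbpr R, short_resolution n M P.
Proof.
move=> /(_ M)[P [PM Pn]]; have [prP P0 _] := PM.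
have bddP : bounded P.
  exists n => i hi; have [i_gt0|i_le0] := boolP (0 < i); first exact: P0.
  by apply: Pn; lia.
exists (KbPr bddP prP); split=> //.
by have [] := proj_resolution_placed PM.
Qed.

(** [ext_eq0] quantifies over all projective resolutions; [hom0_source] transfers vanishing from P
    to any other one. *)
Lemma ext_eq0P n (i : nat) M N (P : kbpr R) : short_resolution n M P ->
  ext_eq0 i M N <-> hom0 i%:Z P (stalk N).
Proof.
move=> [[p [pC pQ]] P0 _]; split=> [H | H P' P'M].
  apply/hom0_stalk; apply: H; split=> //; first by move=> j; exact: kbpr_pr.
  have [F Ff] := chain_map_of_gmap pC; exists F.
  exact/(quasi_isoP Ff).
have [projP' bddP' [p' [p'C p'Q]]] := proj_resolution_placed P'M.
apply/hom0_stalk.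
have := hom0_source (kbpr_projectives P) (kbpr_bounded_above P)
  projP' bddP' pC pQ p'C p'Q H.
by rewrite subrr addr0.
Qed.

Lemma hom0_placed_source n e M l (P Q : kbpr R) Z :
  short_resolution n M P -> placed Q M l ->
  hom0 (e + l) Q Z <-> hom0 e P Z.
Proof.
move=> [[p [pC pQ]] _ _] [q [qC qQ]]; split=> H.
  have := hom0_source (kbpr_projectives Q) (kbpr_bounded_above Q)
    (kbpr_projectives P) (kbpr_bounded_above P) qC qQ pC pQ H.
  by rewrite sub0r addrK.
have := hom0_source (kbpr_projectives P) (kbpr_bounded_above P)
  (kbpr_projectives Q) (kbpr_bounded_above Q) pC pQ qC qQ H.
by rewrite subr0.
Qed.

Lemma hom0_placed_target e N l (X Q : kbpr R) :
  placed Q N l -> hom0 e X Q <-> hom0 (e + l) X (stalk N).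
Proof.
move=> [q [qC qQ]].
exact: (hom0_target e (kbpr_projectives X) (kbpr_bounded_above X) qC qQ).
Qed.

End Placed.

Arguments kbpr_projectives {R} X.
Arguments kbpr_bounded_above {R} X.

(** * Cohomology of perfect complexes *)

Section Cohomology.
Variable R : nzRingType.
Local Notation rmod := (lmodType R^c).
Implicit Types (X Y : complex R) (M N : rmod) (e l : int).

Lemma placed_exact X M l j : placed X M l -> j != - l -> exact X j.
Proof.
move=> [q [_ qQ]] ne x dx; have [inj _] := qQ j (j + l) erefl.
apply: inj => //; exists 0; rewrite linear0.
by apply: stalk_zero; apply: contraNneq ne; lia.
Qed.

Lemma hom0_stalk_zero e X N : is_zero (X (- e)) -> hom0 e X (stalk N).
Proof.
move=> X0; apply/hom0_stalk => f _; exists \0 => x.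
by rewrite [x]X0 linear0.
Qed.

Definition regular : rmod := (R^c)^o.

Lemma regular_pr : is_pr regular.
Proof.
split.
  exists 1%N, (fun=> 1) => x; exists (fun=> x).
  by rewrite big_ord1 [LHS](esym (mulr1 _)).
move=> M N g f gsurj; have [m em] := gsurj (f 1).
have lin : linear (fun a : regular => (a : R^c) *: m).
  by move=> c a b; rewrite scalerDl -scalerA.
exists (mklin lin) => a; rewrite /= linearZ /= em -linearZ; congr (f _).
exact: mulr1.
Qed.

(** A cocycle x is the image of 1 under a map from the regular module; a null-homotopy evaluated at
    1 exhibits x as a boundary. *)
Lemma exact_of_hom0 j X : hom0 j (stalk regular) X -> exact X j.
Proof.
move=> H x dx.
have lin : linear (fun a : regular => (a : R^c) *: x).
  by move=> c a b; rewrite scalerDl -scalerA.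
have [F [F0 FE]] := family_update (@gmap0 _ (stalk regular) X)
  (mklin lin : {linear stalk regular 0 -> X j}).
have [|h hP] := H F.
  move=> i j0 i' j' -> -> -> a; rewrite linear0.
  have [i0 | ne] := eqVneq i 0; last by rewrite [a](stalk_zero ne) !linear0 scaler0.
  move: a; rewrite i0 add0r => a; rewrite F0 /=.
  by rewrite linearZ /= dx !scaler0.
have := hP 0 j 1 (j - 1) (esym (add0r j)) erefl erefl (1 : regular).
rewrite F0 /= linear0 addr0 scale1r => ->.
by exists (sgn R j *: h 0 (j - 1) (1 : regular)); rewrite linear_sgn.
Qed.

Lemma stalk_bounded M : bounded (stalk M).
Proof. by exists 0%N => i hi; apply: stalk_zero; apply/eqP; lia. Qed.

Lemma stalk_pr M : is_pr M -> forall i, is_pr (stalk M i).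
Proof. by move=> prM [[|m]|m] //; exact: is_pr0. Qed.

Definition kbpr_stalk M (prM : is_pr M) : kbpr R :=
  KbPr (stalk_bounded M) (stalk_pr prM).

Lemma short_resolution_stalk n M (prM : is_pr M) :
  short_resolution n M (kbpr_stalk prM).
Proof.
split; first 1 last.
- by move=> i hi; apply: stalk_zero; apply/eqP; lia.
- by move=> i hi; apply: stalk_zero; apply/eqP; lia.
exists (gid (stalk M)); split; first exact/cyc_id/gidE.
apply: qis_id; exact: gidE.
Qed.

End Cohomology.

(** * Cohomology modules, their resolutions, and injectivity of the dual *)

Section FiniteDimensionalCohomology.
Variables (k : fieldType) (Lambda : falgType k).
Local Notation rmod := (lmodType Lambda^c).

Lemma klin0 (M : rmod) (phi : M -> k) : klin phi -> phi 0 = 0.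
Proof.
move=> /(_ 1 0 0); rewrite kact1 addr0 mul1r => /(congr1 (fun t => t - phi 0)).
by rewrite addrK subrr => /esym.
Qed.

Lemma cohomology_module (X : kbpr Lambda) a :
  exists (H : fgmod Lambda) (Z : rmod) (i : {linear Z -> X a})
      (p : {linear Z -> H}),
    [/\ forall x, diff X a (a + 1) x = 0 <-> exists z, i z = x,
        forall h, exists z, p z = h &
        forall z, p z = 0 <-> exists y, i z = diff X (a - 1) a y].
Proof.
have Zsub : is_submodule (fun x : X a => diff X a (a + 1) x = 0).
  by split=> [|c x y ex ey]; rewrite ?linear0 // linearP ex ey scaler0 addr0.
have [Z [i [inj_i iP]]] := submoduleP Zsub.
have Bsub : is_submodule (fun z => exists y, i z = diff X (a - 1) a y).
  split; first by exists 0; rewrite !linear0.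
  by move=> c x y [u eu] [v ev]; exists (c *: u + v); rewrite !linearP eu ev.
have [H [p [psurj pP]]] := quotientP Bsub.
have fgX : finitely_generated (X a) by have [] := kbpr_pr X a.
exists (FgMod (fg_quotient (fg_submodule fgX inj_i) psurj)), Z, i, p.
by split.
Qed.

(** The components in degrees 0 and -1 are built by hand, since X need not be exact at a. Extending
    to degrees -2, ..., -n uses exactness at a - 1, ..., a - n + 1, which is the hypothesis; below
    -n the resolution vanishes. *)
Lemma cohomology_resolution n (X : kbpr Lambda) a :
  (0 < n)%N -> gldim_le Lambda n ->
  (forall j : int, 0 < j < n%:Z -> exact X (a - j)) ->
  exists (H : fgmod Lambda) (P : kbpr Lambda) (s : gmap P X),
    [/\ short_resolution n H P, cyc a s & qis_at s 0 a].
Proof.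
move=> n_gt0 gld exX.
have [H [Z [i [r [iP rsurj rP]]]]] := cohomology_module X a.
have [P PH] := short_resolution_exists H gld.
exists H, P; have [[p [pC pQ]] P_hi P_lo] := PH.
have [s0 s0P] := projective_lift (f := p 0 0 : {linear P 0 -> H})
  (kbpr_projectives P 0) (fun x => rsurj _).
have [s1 s1P] : exists s1 : {linear P (- 1) -> X (a - 1)},
    forall x, diff X (a - 1) a (s1 x) = i (s0 (diff P (- 1) 0 x)).
  apply: (projective_lift (f := i \o s0 \o diff P (- 1) 0) (kbpr_projectives P _)).
  move=> x /=; have [|y ->] := (rP (s0 (diff P (- 1) 0 x))).1; last by exists y.
  by rewrite s0P (pC (- 1) (- 1)) //= scaler0.
have [h0 [h00 h0E]] := family_update (@gmap0 _ P X) (i \o s0 : {linear P 0 -> X a}).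
(* The sign is the one in the chain map relation of degree a. *)
have [h1 [h11 h1E]] := family_update h0 (slin a s1).
have h10 : h1 0 a = i \o s0 by rewrite h1E // h00.
(* A null-homotopy of the zero map of degree a + 1 is exactly a chain map of degree a, so the
   extension lemma for homotopies also extends chain maps. *)
have [||| j hj | h [hP hE]] := @extend_homotopy _ P X (a + 1) (@gmap0 _ P X) h1 (- 1).
- exact: kbpr_projectives.
- by move=> ? ? ? ? _ _ _ x; rewrite !linear0 scaler0.
- move=> j hj j' i' l -> -> -> x; rewrite /=.
  have [j0 | ne0] := eqVneq j 0.
    move: x; rewrite j0 !add0r addrK h10 => x /=.
    have dz : diff X a (a + 1) (i (s0 x)) = 0 by apply/iP; exists (s0 x).
    rewrite dz scaler0 add0r.
    have -> : diff P 0 1 x = 0 by apply: P_hi.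
    by rewrite linear0.
  have [j1 | ne1] := eqVneq j (- 1).
    move: x; rewrite j1 addNr => x.
    have -> : - 1 + (a + 1) = a by lia.
    rewrite h11 h10 /= slinE linear_sgn s1P scalerA -sgnD.
    rewrite (@sgn_odd _ _ 1) ?sgn1 ?scaleN1r ?addNr //; lia.
  have -> : x = 0 by apply: P_hi; move/eqP: ne0; move/eqP: ne1; lia.
  by rewrite !linear0 scaler0 addr0.
- have [lo | hi] := boolP (j < - n%:Z); first by left; apply: P_lo.
  right; have -> : j + (a + 1) = a - (- j - 1) by lia.
  by apply: exX; lia.
exists h; split=> //.
  move=> j j' i' l -> -> -> x.
  have := hP j _ _ _ erefl erefl erefl x.
  rewrite addrA addrK sgnD sgn1 mulrN1 scaleNr /= => /esym/eqP.
  by rewrite addr_eq0 eqr_opp => /eqP.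
have h0a x : h 0 a x = i (s0 x) by rewrite hE // h10.
have [pinj psur] := pQ 0 0 erefl.
split=> [x dx [w] | w].
  rewrite h0a => ew; apply: pinj => //; exists 0; rewrite linear0.
  by rewrite -s0P; apply/rP; exists w.
move=> /iP[z <-]; have [x [w' [dx ez]]] := psur (r z : stalk H 0) erefl.
have [|y ey] := (rP (z - s0 x)).1.
  by rewrite linearB s0P ez /= addr0 subrr.
by exists x, y; split=> //; rewrite h0a -ey linearB addrC subrK.
Qed.

(** If a cocycle x were not a boundary, some functional would vanish on boundaries and be 1 at x.
    The map to D it defines factors through the differential, which kills x: a contradiction. *)
Lemma exact_of_hom0_dual (X : kbpr Lambda) e (D : rmod) (ev : D -> k) : is_dual ev ->
  hom0 e X (stalk D) -> exact X (- e).
Proof.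
move=> [evL Dex Duniq] /hom0_stalk HX x dx; apply: contrapT => nx.
have fgX : finitely_generated (X (- e)) by have [] := kbpr_pr X (- e).
pose G (y : X (- e)) t := exists b c, y = diff X (- e - 1) (- e) b + kact c x /\ t = c.
have [|a y z s t [b [c [-> ->]]] [b' [c' [-> ->]]]|t [b [c [e0 ->]]]|psi [psiL psiP]] :=
  @functional_extension _ _ _ G fgX.
- by exists 0, 0; rewrite linear0 kact0 addr0.
- exists (kact a b + b'), (a * c + c'); split=> //.
  by rewrite kactDr kactA kactDl linearD linear_kact addrACA.
- apply: contrapT => c0; apply: nx; exists (kact (- c^-1) b).
  have /eqP cn0 : c <> 0 by [].
  have : kact c x = - diff X (- e - 1) (- e) b.
    by apply/eqP; rewrite -addr_eq0 addrC -e0.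
  move=> /(congr1 (kact c^-1)); rewrite kactA mulVf // kact1 => ->.
  by rewrite linear_kact /kact scalerN scaleNr scaleNr.
have [f fP] := Dex _ _ psiL.
have ev0 : ev 0 = 0 := klin0 evL.
have [|g gP] := HX f.
  move=> b; pose z : {linear X (- e - 1) -> D} := \0.
  apply: (Duniq _ (f \o diff X (- e - 1) (- e)) z) => {}b.
  rewrite /z /= fP ev0; apply: psiP; exists b, 0.
  by rewrite kact0 addr0.
have Gx : G x 1 by exists 0, 1; rewrite linear0 add0r kact1.
have := psiP x 1 Gx; rewrite -fP gP dx linear0 ev0 => /esym/eqP.
by rewrite oner_eq0.
Qed.

(** Exactness of the resolution at -i makes [ev] of f well defined on the image of the differential;
    an extension to the whole term is a functional, hence a map to D. *)
Lemma ext_dual n (M : fgmod Lambda) (i : nat) (D : rmod) (ev : D -> k) :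
  (0 < i)%N -> gldim_le Lambda n -> is_dual ev -> ext_eq0 i M D.
Proof.
move=> i_gt0 gld [evL Dex Duniq].
have [P PM] := short_resolution_exists M gld.
apply/(ext_eq0P _ _ PM)/hom0_stalk => f fd.
have [PM0 _ _] := PM.
have exP : exact P (- i%:Z) by apply: placed_exact PM0 _; apply/eqP; lia.
have ev0 : ev 0 = 0 := klin0 evL.
have fgP : finitely_generated (P (- i%:Z + 1)) by have [] := kbpr_pr P (- i%:Z + 1).
pose G y t := exists x, y = diff P (- i%:Z) (- i%:Z + 1) x /\ t = ev (f x).
have [|a y z s t [x [-> ->]] [x' [-> ->]]|t [x [dx ->]]|psi [psiL psiP]] :=
  @functional_extension _ _ _ G fgP.
- by exists 0; rewrite !linear0 ev0.
- exists (kact a x + x'); rewrite !linearD !linear_kact; split=> //.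
  by rewrite evL.
- by have [x' ->] := exP x (esym dx); rewrite fd ev0.
have [g gP] := Dex _ _ psiL; exists g.
apply: (Duniq _ f (g \o diff P (- i%:Z) (- i%:Z + 1))) => x /=.
by rewrite gP; apply/esym/psiP; exists x.
Qed.

End FiniteDimensionalCohomology.

(** * Rigidity and maximality *)

Lemma int_interval (N : nat) : exists L : seq int,
  uniq L /\ forall l : int, (`|l| <= N)%N -> l \in L.
Proof.
exists (map (fun t : nat => t%:Z - N%:Z) (iota 0 (N + N).+1)); split.
  by rewrite map_inj_uniq ?iota_uniq // => x y; lia.
move=> l hl; apply/mapP; exists (absz (l + N%:Z)); last by lia.
by rewrite mem_iota; lia.
Qed.

Section ClusterTilting.
Variables (k : fieldType) (Lambda : falgType k) (n : nat).
Variable C : modcat Lambda -> Prop.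
Hypotheses (n_gt0 : (0 < n)%N) (gld : gldim_le Lambda n).
Hypothesis C_ct : abs_cluster_tilting n C.

Local Notation B := (shifts n C).
Implicit Types (X Y Q P : kbpr Lambda) (M N : fgmod Lambda) (e l : int).

Lemma shifts_gen Q M l : C M -> placed Q M (l * n%:Z) -> B Q.
Proof.
move=> CM QM; apply: add_gen; exists M, l; split=> //.
exact/derived_isoP/QM/kbpr_bounded_above/kbpr_projectives.
Qed.

Lemma shifts_hom0l e (Z : complex Lambda) :
  (forall Q M l, C M -> placed Q M (l * n%:Z) -> hom0 e Q Z) ->
  forall X, B X -> hom0 e X Z.
Proof.
move=> H; apply: add_hom0l => Q [M [l [CM QM]]]; apply: H CM _.
exact/derived_isoP/QM/kbpr_bounded_above/kbpr_projectives.
Qed.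

Lemma shifts_hom0r e (Z : complex Lambda) :
  (forall Q M l, C M -> placed Q M (l * n%:Z) -> hom0 e Z Q) ->
  forall X, B X -> hom0 e Z X.
Proof.
move=> H; apply: add_hom0r => Q [M [l [CM QM]]]; apply: H CM _.
exact/derived_isoP/QM/kbpr_bounded_above/kbpr_projectives.
Qed.

Lemma shifts_rigid X Y (i : nat) : B X -> B Y -> (0 < i < n)%N -> hom0 i%:Z X Y.
Proof.
move=> BX BY lt_in; move: X BX; apply: shifts_hom0l => Q M l CM QM.
move: Y BY; apply: shifts_hom0r => Q' M' l' CM' QM'.
apply/(hom0_placed_target _ _ QM').
have [P PM] := short_resolution_exists M gld.
have [_ P_hi P_lo] := PM.
have -> : i%:Z + l' * n%:Z = i%:Z + (l' - l) * n%:Z + l * n%:Z by rewrite mulrBl; lia.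
apply/(hom0_placed_source _ _ PM QM).
(* With t = l' - l, the degree i + t n is negative for t < 0 and exceeds n for t > 0; in both cases
   it misses the resolution. *)
have [t_lo | t_ge] := boolP (l' - l < 0).
  by apply/hom0_stalk_zero/P_hi; nia.
have [t_hi | t_le] := boolP (0 < l' - l).
  by apply/hom0_stalk_zero/P_lo; nia.
have -> : l' - l = 0 by lia.
rewrite mul0r addr0; apply/(ext_eq0P _ _ PM).
by have [_ _ C3 _] := C_ct; exact: (C3 M).1.
Qed.

Lemma regular_in : C (FgMod (regular_pr Lambda).1).
Proof.
have [_ _ C3 _] := C_ct; apply/C3 => Y _ i lt_in.
apply/(ext_eq0P _ _ (short_resolution_stalk n (regular_pr Lambda))).
by apply/hom0_stalk_zero/stalk_zero/eqP; lia.
Qed.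

Lemma ndvd_decomp (j : int) : ~~ (n%:Z %| j)%Z ->
  exists (i : nat) (l : int), (0 < i < n)%N /\ j = i%:Z + l * n%:Z.
Proof.
move=> nd; exists `|(j %% n%:Z)%Z|%N, (j %/ n%:Z)%Z.
have n0 : n%:Z != 0 by lia.
have h0 := modz_ge0 j n0; have h1 := ltz_mod j n0.
have h2 : (j %% n%:Z)%Z != 0 by apply: contraNneq nd => e; apply/dvdz_mod0P.
split; first lia.
by rewrite gez0_abs // addrC -divz_eq.
Qed.

Lemma exact_left X :
  (forall Y, B Y -> forall i : nat, (0 < i < n)%N -> hom0 i%:Z Y X) ->
  forall j, ~~ (n%:Z %| j)%Z -> exact X j.
Proof.
move=> H j /ndvd_decomp[i [l [lt_in ->]]].
apply: exact_of_hom0; have pr := regular_pr Lambda.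
have BY : B (kbpr_shift (kbpr_stalk pr) (- l * n%:Z)).
  apply: (shifts_gen regular_in).
  exact: placed_resolution_shift (short_resolution_stalk n pr).
by have /hom0_shiftl := H _ BY i lt_in; rewrite mulNr opprK.
Qed.

Lemma exact_right X :
  (forall Y, B Y -> forall i : nat, (0 < i < n)%N -> hom0 i%:Z X Y) ->
  forall j, ~~ (n%:Z %| j)%Z -> exact X j.
Proof.
move=> H j nd.
have [D [ev [fgD D_dual]]] := dual_module_exists Lambda.
have CD : C (FgMod fgD).
  have [_ _ _ C4] := C_ct; apply/C4 => Y _ i /andP[i_gt0 _].
  exact: ext_dual gld D_dual.
have [i [l [lt_in ej]]] : exists (i : nat) (l : int),
    (0 < i < n)%N /\ - j = i%:Z + l * n%:Z.
  by apply: ndvd_decomp; rewrite dvdzE abszN -dvdzE.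
rewrite -[j]opprK ej; apply: exact_of_hom0_dual D_dual _.
have [P PD] := short_resolution_exists (FgMod fgD) gld.
have PDl := placed_resolution_shift (l * n%:Z) PD.
have BP : B (kbpr_shift P (l * n%:Z)) := shifts_gen CD PDl.
have := H _ BP i lt_in.
by move=> /(hom0_placed_target _ _ PDl).
Qed.

(** The modules M are arbitrary here; their membership in C comes afterwards from orthogonality,
    through [stalk_sum_shifts]. *)
Inductive stalk_sum : kbpr Lambda -> Prop :=
| stalk_sum0 : stalk_sum (kbpr0 Lambda)
| stalk_sumS M l Q Y : placed Q M (l * n%:Z) -> stalk_sum Y ->
    stalk_sum (kbpr_sum Q Y).

Lemma stalk_sum_shifts (Phi : kbpr Lambda -> Prop) Q :
  (forall X Y, retract X Y -> Phi Y -> Phi X) ->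
  (forall Y M l, placed Y M (l * n%:Z) -> Phi Y -> C M) ->
  stalk_sum Q -> Phi Q -> B Q.
Proof.
move=> Phi_retract PhiC; elim=> {Q} [_ | M l Q Y QM _ IH PhiQY].
  exact: add_zero.
apply: add_dsum; last first.
  by apply: IH; exact: (Phi_retract _ (kbpr_sum Q Y) (retract_sum_right _ _) PhiQY).
apply: shifts_gen (QM); apply: PhiC (QM) _.
exact: (Phi_retract _ (kbpr_sum Q Y) (retract_sum_left _ _) PhiQY).
Qed.

(** Induction on the list of degrees to be matched: each step adds a shifted resolution of one
    cohomology module. Exactness of Y elsewhere keeps the summands from interfering. *)
Lemma partial_decomposition X (L : seq int) :
  (forall j, ~~ (n%:Z %| j)%Z -> exact X j) -> uniq L ->
  exists Y (q : gmap Y X), [/\ stalk_sum Y, cyc 0 q,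
    forall j : int, j \notin map (fun l => - (l * n%:Z)) L -> exact Y j &
    forall j : int, j \in map (fun l => - (l * n%:Z)) L -> qis_at q j j].
Proof.
move=> exX; elim: L => [_|l L IH /= /andP[lL uL]].
  exists (kbpr0 Lambda), (@gmap0 _ (kbpr0 Lambda) X); split=> //.
  - exact: stalk_sum0.
  - by move=> ? ? ? ? _ _ _ x; rewrite /= linear0 scaler0.
  - by move=> j _ x _; exists 0; rewrite [x]rmod0_is_zero.
have [Y [q [sY qC exY qQ]]] := IH uL.
set a := - (l * n%:Z).
have [|H [P [s [PH sC sQ]]]] := @cohomology_resolution _ _ n X a n_gt0 gld.
  move=> j hj; apply: exX.
  apply/negP => /dvdzP[t et].
  have ej : j = (- l - t) * n%:Z by rewrite mulrBl mulNr -et opprB addrC subrK.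
  move: ej hj; move: (- l - t) => r -> hj.
  by have [r_gt0 | r_le0] := boolP (0 < r); nia.
have [PH0 P_hi P_lo] := PH.
pose Q := kbpr_shift P (- a).
have QH : placed Q H (l * n%:Z).
  have el : l * n%:Z = - a by rewrite opprK.
  by rewrite el; exact: placed_resolution_shift PH.
pose s' := gshiftl (- a) s : gmap Q X.
have s'C : cyc 0 s' by have := @cyc_shiftl _ (- a) _ _ _ _ sC; rewrite addrN.
have s'Q : qis_at s' a a by apply: qis_at_shiftl; rewrite addrN.
have exQ j : j != a -> exact Q j by move=> ne; apply: placed_exact QH _.
have lin i j : linear (fun p : complex_sum Q Y i => s' i j p.1 + q i j p.2).
  by move=> c x y; rewrite /= !linearP scalerDr addrACA.
pose t : gmap (kbpr_sum Q Y) X := fun i j => mklin (lin i j).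
(* Distinct entries of L give distinct degrees, so Y is exact at a and only the new summand
   contributes there. *)
have aL : a \notin map (fun l => - (l * n%:Z)) L.
  rewrite (mem_map (f := fun l => - (l * n%:Z))) // => x y /oppr_inj.
  by apply: mulIf; lia.
exists (kbpr_sum Q Y), t; split.
- exact: stalk_sumS QH sY.
- move=> i j i' j' ej ei' ej' x.
  rewrite /t /= /prod_fun /= (s'C i j i' j' ej ei' ej') (qC i j i' j' ej ei' ej').
  by rewrite -scalerDr -linearD.
- move=> j; rewrite inE negb_or => /andP[ja jL] [x y] [dx dy].
  have [x' ->] := exQ j ja x dx; have [y' ->] := exY j jL y dy.
  by exists (x', y').
move=> j; rewrite inE => /orP[/eqP -> | jL].
  have [inj sur] := s'Q; split=> [[x y] [dx dy] [w] | w dw].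
    have [y' ey] := exY a aL y dy; rewrite /t /= ey (cyc_pred _ qC) ?addr0 //.
    rewrite scale1r => ew.
    have [|x' ->] := inj x dx; last by exists (x', y').
    exists (w - q (a - 1) (a - 1) y').
    by rewrite linearB -ew addrK.
  have [x [w' [dx ->]]] := sur w dw; exists (x, 0), w'.
  rewrite /t /= linear0 addr0; split=> //.
  by rewrite /prod_fun /= dx linear0.
have ja : j != a by apply: contraNneq aL => <-.
have [inj sur] := qQ j jL; split=> [[x y] [dx dy] [w] | w dw].
  have [x' ex] := exQ j ja x dx; rewrite /t /= ex (cyc_pred _ s'C) ?addr0 //.
  rewrite scale1r => ew.
  have [|y' ->] := inj y dy; last by exists (x', y').
  exists (w - s' (j - 1) (j - 1) x').
  by rewrite linearB -ew [RHS]addrAC subrr add0r.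
have [y [w' [dy ->]]] := sur w dw; exists (0, y), w'.
rewrite /t /= linear0 add0r; split=> //.
by rewrite /prod_fun /= dy linear0.
Qed.

Lemma decomposition X : (forall j, ~~ (n%:Z %| j)%Z -> exact X j) ->
  exists Y, stalk_sum Y /\ @iso (Kbcat Lambda) Y X.
Proof.
move=> exX; have [N XN] := kbpr_bounded X.
have [L [uL LN]] := int_interval N.
have [Y [q [sY qC exY qQ]]] := partial_decomposition exX uL.
exists Y; split=> //; apply: qis_iso qC _ => i j; rewrite addr0 => ->.
have [iL | iL] := boolP (i \in map (fun l => - (l * n%:Z)) L); first exact: qQ.
split=> [x dx _ | w dw]; first exact: exY.
have [w' ->] : exists w', w = diff X (i - 1) i w'.
  have [/dvdzP[l el] | nd] := boolP (n%:Z %| i)%Z; last exact: exX.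
  have Xi : is_zero (X i).
    apply: XN; rewrite ltnNge; apply: contraNN iL => iN.
    apply/mapP; exists (- l); last by rewrite mulNr opprK.
    apply: LN; apply: leq_trans iN; rewrite el abszM abszN.
    exact: leq_pmulr.
  by exists 0; rewrite [w]Xi linear0.
by exists 0, w'; rewrite !linear0 add0r.
Qed.

(** Each summand M[ln] of X is tested against N[ln] with the same l, which recovers Ext^i(N, M). *)
Lemma shifts_left X :
  (forall Y, B Y -> forall i : nat, (0 < i < n)%N -> hom0 i%:Z Y X) -> B X.
Proof.
move=> HX; have [Y [sY YX]] := decomposition (exact_left HX).
apply: (add_iso YX).
pose Phi Y := forall Z, B Z -> forall i : nat, (0 < i < n)%N -> hom0 i%:Z Z Y.
apply: (@stalk_sum_shifts Phi) sY _ =>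
  [Z Z' ZZ' H T BT i lt_in | Z M l ZM H | Z BZ i lt_in].
- exact/(hom0_retractr ZZ')/H.
- have [_ _ _ C4] := C_ct; apply/C4 => N CN i lt_in.
  have [P PN] := short_resolution_exists N gld.
  apply/(ext_eq0P _ _ PN).
  have PNl := placed_resolution_shift (l * n%:Z) PN.
  have BP : B (kbpr_shift P (l * n%:Z)) := shifts_gen CN PNl.
  have := H _ BP i lt_in => /(hom0_placed_target _ _ ZM).
  by move=> /(hom0_placed_source _ _ PN PNl).
- apply: hom0_retractr (HX _ BZ i lt_in).
  have [F [G [GF FG]]] := YX; apply: iso_retract; by exists G, F.
Qed.

Lemma shifts_right X :
  (forall Y, B Y -> forall i : nat, (0 < i < n)%N -> hom0 i%:Z X Y) -> B X.
Proof.
move=> HX; have [Y [sY YX]] := decomposition (exact_right HX).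
apply: (add_iso YX).
pose Phi Y := forall Z, B Z -> forall i : nat, (0 < i < n)%N -> hom0 i%:Z Y Z.
apply: (@stalk_sum_shifts Phi) sY _ =>
  [Z Z' ZZ' H T BT i lt_in | Z M l ZM H | Z BZ i lt_in].
- exact/(hom0_retractl ZZ')/H.
- have [_ _ C3 _] := C_ct; apply/C3 => N CN i lt_in.
  have [P PM] := short_resolution_exists M gld.
  have [P' PN] := short_resolution_exists N gld.
  apply/(ext_eq0P _ _ PM)/(hom0_placed_source _ _ PM ZM).
  have PNl := placed_resolution_shift (l * n%:Z) PN.
  have BP : B (kbpr_shift P' (l * n%:Z)) := shifts_gen CN PNl.
  have := H _ BP i lt_in.
  by move=> /(hom0_placed_target _ _ PNl).
- apply: hom0_retractl (HX _ BZ i lt_in).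
  have [F [G [GF FG]]] := YX; apply: iso_retract; by exists G, F.
Qed.

End ClusterTilting.

(** * Approximations *)

Section Factorization.
Variable R : nzRingType.
Local Notation rmod := (lmodType R^c).
Implicit Types (X Y Z : complex R) (e : int).

(** The left approximation property of u : X -> Y[e], tested on one object Z so that it can be
    propagated through [add]. *)
Definition factors e X Y (u : gmap X Y) Z := forall f : gmap X Z, cyc e f ->
  exists h : gmap Y Z, cyc 0 h /\ null e (gsub f (gcomp e h u)).

Lemma factors_hom0 e X Y (u : gmap X Y) Z : hom0 e X Z -> factors e u Z.
Proof.
move=> XZ f fC; exists (@gmap0 _ Y Z); split.
  by move=> ? ? ? ? _ _ _ x; rewrite /= linear0 scaler0.
by apply: null_eq (XZ f fC) => i x; rewrite /= subr0.
Qed.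

Lemma factors_retract e X Y (u : gmap X Y) Z Z' :
  retract Z Z' -> factors e u Z' -> factors e u Z.
Proof.
move=> [i [r [iC rC ri]]] H f fC.
have ifC : cyc e (gcomp e i f) by have := cyc_comp iC fC; rewrite addr0.
have [h [hC hP]] := H _ ifC; exists (gcomp 0 r h); split.
  by have := cyc_comp rC hC; rewrite addr0.
have n1 := gcomp_null_subr rC hP; have n2 := gcomp_null_subl fC ri.
rewrite addr0 in n1 n2; apply: null_eq (null_sub n1 n2) => j x.
rewrite /gsub /= /gcomp /= !addr0 gidE /=.
by rewrite opprB [LHS]addrC addrA subrK.
Qed.

Lemma factors_sum e X Y (u : gmap X Y) Z Z' :
  factors e u Z -> factors e u Z' -> factors e u (complex_sum Z Z').
Proof.
move=> H H' f fC.
have [|h [hC [k kP]]] := H (fun i j => proj_left _ _ \o f i j).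
  by move=> i j i' j' ej ei' ej' x /=; rewrite (fC i j i' j').
have [|h' [h'C [k' k'P]]] := H' (fun i j => proj_right _ _ \o f i j).
  by move=> i j i' j' ej ei' ej' x /=; rewrite (fC i j i' j').
exists (fun i j => mklin (pair_map_linear (h i j) (h' i j))); split.
  move=> i j i' j' ej ei' ej' x.
  by rewrite /= /pair_map (hC i j i' j') // (h'C i j i' j').
exists (fun i j => mklin (pair_map_linear (k i j) (k' i j))).
move=> i j i' j' ej ei' ej' x.
have := kP i j i' j' ej ei' ej' x; have := k'P i j i' j' ej ei' ej' x.
rewrite /gsub /gcomp /= /pair_map; case: (f i j x) => y z /= e1 e2.
by congr pair; [exact: e2 | exact: e1].
Qed.

Lemma factors_pair e X Y Y' (u : gmap X Y) (u' : gmap X Y') :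
  cyc e u -> cyc e u' -> exists v : gmap X (complex_sum Y Y'), cyc e v /\
    forall Z, factors e u Z \/ factors e u' Z -> factors e v Z.
Proof.
move=> uC u'C.
exists (fun i j => mklin (pair_map_linear (u i j) (u' i j))); split.
  move=> i j i' j' ej ei' ej' x.
  by rewrite /= /pair_map (uC i j i' j') // (u'C i j i' j').
move=> Z [] H f fC; have [h [hC hP]] := H f fC.
  exists (fun i j => h i j \o proj_left _ _); split.
    by move=> i j i' j' ej ei' ej' x; rewrite /= (hC i j i' j').
  by apply: null_eq hP.
exists (fun i j => h i j \o proj_right _ _); split.
  by move=> i j i' j' ej ei' ej' x; rewrite /= (hC i j i' j').
by apply: null_eq hP.
Qed.

(** * The triangle of a cocone *)

Section CoconeMaps.
Variables (X Y : complex R) (e : int) (u : gmap X Y).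
Hypothesis uC : cyc e u.
Local Notation T := (cocone uC).

Lemma cocone_projection : exists p : gmap T X,
  cyc 0 p /\ forall i x, p i i x = x.1.
Proof.
have [p pP] := family_extension (fun i => proj_left _ _ : {linear T i -> X i}).
exists p; split=> [i j i' j' | i x]; last by rewrite pP.
by rewrite addr0 => -> -> -> x; rewrite !pP scale1r.
Qed.

Variables (p : gmap T X).
Hypothesis pE : forall i x, p i i x = x.1.

Lemma cocone_comp_null : null e (gcomp 0 u p).
Proof.
have [w wP] := family_extension (s := fun i => i + (e - 1))
  (fun i => proj_right _ _ : {linear T i -> Y (i + (e - 1))}).
have wE i (x : T i) : w i (i + (e - 1)) x = x.2 by rewrite wP.
exists w => i j i' j' -> -> -> [t b]; rewrite /gcomp /= addr0 pE.
rewrite -[i + e - 1]addrA wE; have -> : i + e = i + 1 + (e - 1) by lia.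
rewrite wE /= /cocone_link eqxx sgnD sgn1 mulrN1 scaleNr.
by rewrite [RHS]addrC subrK.
Qed.

Lemma cocone_lift Z (c : gmap Z X) : cyc 0 c -> null e (gcomp 0 u c) ->
  exists c' : gmap Z T, cyc 0 c' /\ forall i x, gcomp 0 p c' i i x = c i i x.
Proof.
move=> cC [h hP]; exists (to_cocone uC c h); split.
  apply: to_cocone_cyc => // i x; rewrite !addr0 scale1r.
  have := hP i (i + e) _ _ erefl erefl erefl x; rewrite /gcomp /= addr0 => ->.
  by rewrite sgnD sgn1 mulrN1 scaleNr [RHS]addrAC subrr add0r.
by move=> i x; rewrite /gcomp /= addr0 pE.
Qed.

(** Exactness of Hom(X, Z[d]) -> Hom(T, Z[d]) -> Hom(Y[e-1], Z[d]) in the middle. If h is a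
    null-homotopy of f on Y[e-1], then f - h u is a chain map on X. *)
Lemma cocone_factor d Z (f : gmap T Z) : cyc d f -> hom0 d (shift Y (e - 1)) Z ->
  exists g : gmap X Z, cyc d g /\ null d (gsub f (gcomp 0 g p)).
Proof.
move=> fC H.
pose fY : gmap (shift Y (e - 1)) Z :=
  fun i j => f i j \o (incl_right _ _ : {linear Y (i + (e - 1)) -> T i}).
have fYE i j b : fY i j b = f i j (0, b) by [].
have dY i b : diff T i (i + 1) (0, b) = (0, diff (shift Y (e - 1)) i (i + 1) b).
  rewrite cocone_diffE !linear0 add0r shiftE; congr (_, _ *: _).
  by apply: sgn_odd; lia.
have fYC : cyc d fY.
  by move=> i j i' j' ej -> ej' x; rewrite !fYE -dY (fC i j _ j').
have [h hP] := H fY fYC.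
pose g : gmap X Z := fun i j =>
  (f i j \o (incl_left _ _ : {linear X i -> T i}))
  \- (h (i + 1) j \o u i (i + 1 + (e - 1))).
have gE i j t : g i j t = f i j (t, 0) - h (i + 1) j (u i (i + 1 + (e - 1)) t) by [].
have dX i t : diff T i (i + 1) (t, 0) =
    (diff X i (i + 1) t, 0) + (0, u i (i + 1 + (e - 1)) t) :> T (i + 1).
  rewrite cocone_diffE /cocone_link eqxx linear0 scaler0 addr0.
  by congr pair; rewrite /= ?addr0 ?add0r.
exists g; split.
  move=> i j i' j' -> -> -> t; rewrite !gE linearB scalerBr.
  have := fC i (i + d) _ _ erefl erefl erefl (t, 0).
  rewrite dX linearD -fYE (hP (i + 1) (i + d + 1) (i + 1 + 1) (i + d)) //; try lia.
  have -> : diff (shift Y (e - 1)) (i + 1) (i + 1 + 1) (u i (i + 1 + (e - 1)) t) =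
      - u (i + 1) (i + 1 + 1 + (e - 1)) (diff X i (i + 1) t).
    rewrite shiftE (uC (i := i) (j := i + 1 + (e - 1))) //; try lia.
    by rewrite sgnD sgnN sgn1 mulrN1 scaleNr.
  rewrite linearN addrA => /(canRL (subrK _)) /(canRL (addrK _)) ->.
  by rewrite [LHS]addrAC addrK.
have [p2 p2P] := family_extension (s := fun i => i + (e - 1))
  (fun i => proj_right _ _ : {linear T i -> Y (i + (e - 1))}).
have p2E i (x : T i) : p2 i (i + (e - 1)) x = x.2 by rewrite p2P.
exists (fun i j => h i j \o p2 i (i + (e - 1))) => i j i' j' -> -> -> [t b].
have ftb : f i (i + d) (t, b) = f i (i + d) (t, 0) + fY i (i + d) b.
  by rewrite fYE -linearD; congr (f _ _ _); congr pair; rewrite /= ?addr0 ?add0r.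
rewrite -[LHS]/(f i (i + d) (t, b) - g (i + 0) (i + d) (p i (i + 0) (t, b))).
rewrite ftb addr0 pE gE (hP i (i + d) (i + 1) (i + d - 1)) //.
have cancel (V : zmodType) (x y z w : V) : x + (y + z) - (x - w) = y + (z + w).
  by rewrite opprB addrC addrA subrK addrC addrA.
rewrite cancel /= !p2E /=.
congr (_ + _); rewrite -linearD; congr (h _ _ _).
rewrite /cocone_link eqxx [LHS]addrC; congr (_ + _).
by rewrite shiftE; congr (_ *: _); apply: sgn_odd; lia.
Qed.




End CoconeMaps.

End Factorization.

(** * Approximations by the subcategory C[nZ] *)

Section Approximations.
Variables (k : fieldType) (Lambda : falgType k) (n : nat).
Variable C : modcat Lambda -> Prop.
Hypotheses (n_gt0 : (0 < n)%N) (gld : gldim_le Lambda n).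
Hypothesis C_ct : abs_cluster_tilting n C.

Local Notation B := (shifts n C).
Implicit Types (X Y Z Q P T : kbpr Lambda) (M N : fgmod Lambda) (e l : int).

(* Maps from X to a stalk complex are maps from the cokernel of a differential
   of X, so a left C-approximation of that cokernel suffices. *)
Lemma left_approximation_degree X e l : exists Y (u : gmap X Y),
  [/\ B Y, cyc e u &
      forall Z N, C N -> placed Z N (l * n%:Z) -> factors e u Z].
Proof.
(* Maps from X to N[ln][e] have degree a into the stalk of N, hence live on X^(-a). *)
set a := e + l * n%:Z.
pose im (x : X (- a)) := exists y, x = diff X (- a - 1) (- a) y.
have im_sub : is_submodule im.
  split; first by exists 0; rewrite linear0.
  by move=> c x y [x' ->] [y' ->]; exists (c *: x' + y'); rewrite linearP.
have [K [r [rsurj rP]]] := quotientP im_sub.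
have fgX : finitely_generated (X (- a)) by have [] := kbpr_pr X (- a).
have [_ [_ C_left] _ _] := C_ct.
have [M [f [CM fP]]] := C_left (FgMod (fg_quotient fgX rsurj)).
have [P PM] := short_resolution_exists (M : fgmod Lambda) gld.
have [q [qC qQ]] := placed_resolution_shift (l * n%:Z) PM.
set Y := kbpr_shift P (l * n%:Z) in q qC qQ.
have rd x : r (diff X (- a - 1) (- a) x) = 0 by apply/rP; exists x.
pose fr : {linear X (- a) -> M} := (f : {linear K -> M}) \o r.
have [|F [FC F0]] := cyc_stalk (f := fr).
  by move=> x; rewrite /fr /= rd linear0.
have projX := kbpr_projectives X; have bddX := kbpr_bounded_above X.
have [u [uC uP]] := lift_qis projX bddX qC qQ FC.
exists Y, u; split=> //.
  by apply: (shifts_gen CM); exact: placed_resolution_shift PM.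
move=> Z N CN [q' [q'C q'Q]] g gC.
have q'gC := cyc_comp q'C gC.
pose g0 : {linear X (- a) -> N} := gcomp e q' g (- a) 0.
have [g1 g1P] : exists g1 : {linear K -> N}, forall x, g1 (r x) = g0 x.
  apply: (linear_factor_epi rsurj) => x /rP[y ->].
  have := q'gC (- a - 1) (- 1) (- a) 0 _ _ _ y.
  by rewrite scaler0 => -> //; lia.
have [m mP] := fP (N : modcat Lambda) g1 CN.
(* The factorization found in the module category is viewed as a map of stalks, then lifted along
   [q'] to a map Y -> Z. *)
have [|mm [mmC mm0]] := @cyc_stalk _ 0 (stalk M) N (m : {linear stalk M (- 0) -> N}).
  by move=> x; rewrite linear0.
have {}mm0 : mm 0 0 = (m : {linear M -> N}) := mm0.
have mqC := cyc_comp mmC qC; rewrite addr0 -[l * _]add0r in mqC.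
have projY := kbpr_projectives Y; have bddY := kbpr_bounded_above Y.
have [h [hC hP]] := lift_qis projY bddY q'C q'Q mqC.
exists h; split=> //.
apply: (lift_qis_null projX bddX q'C q'Q).
  apply: cyc_sub => //; by have := cyc_comp hC uC; rewrite addr0.
rewrite add0r in hP.
have eF x : gcomp a mm F (- a) 0 x = (m : {linear M -> N}) (fr x).
  by rewrite /gcomp /= addNr mm0 F0.
have eg x : gcomp e q' g (- a) 0 x = (m : {linear M -> N}) (fr x).
  by rewrite -[LHS]/(g0 x) -g1P -[LHS](mP (r x)).
have n1 : null a (gsub (gcomp e q' g) (gcomp a mm F)).
  apply: null0 => i x; have [ia | ne] := eqVneq (i + a) 0; last first.
    exact: (stalk_zero ne).
  have ei : i = - a by lia.
  move: x; rewrite ei addNr => x.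
  by rewrite -[LHS]/(gcomp e q' g (- a) 0 x - gcomp a mm F (- a) 0 x) eF eg subrr.
have n2 := gcomp_null_subr mmC uP; rewrite addr0 -/a in n2.
have n3 := gcomp_null_subl uC hP; rewrite -/a in n3.
have n4 : null a (gsub (gcomp a mm F) (gcomp e (gcomp (l * n%:Z) mm q) u)).
  by apply: null_eq n2 => i x; rewrite /gsub /gcomp /= -/a addrA.
apply: null_eq (null_trans n1 (null_trans n4 n3)) => i x.
by rewrite /gsub /gcomp /= !addr0 linearB.
Qed.

Lemma left_approximation X e : exists Y (u : gmap X Y),
  [/\ B Y, cyc e u & forall Z, B Z -> factors e u Z].
Proof.
have [m Xm] := kbpr_bounded X.
(* Finitely many l suffice: for |l| > m + |e| one has |e + l n| > m, so the relevant term of X is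
   zero and all maps are null. *)
have [L [_ LP]] := int_interval (m + absz e).
have [Y [u [BY uC uL]]] : exists Y (u : gmap X Y), [/\ B Y, cyc e u &
    forall l Z N, l \in L -> C N -> placed Z N (l * n%:Z) -> factors e u Z].
  elim: L {LP} => [|l L [Y [u [BY uC uL]]]].
    exists (kbpr0 Lambda), (@gmap0 _ X (kbpr0 Lambda)); split=> //.
      exact: add_zero.
    by move=> ? ? ? ? _ _ _ x; rewrite !linear0 scaler0.
  have [Y' [u' [BY' u'C u'l]]] := left_approximation_degree X e l.
  have [v [vC vP]] := factors_pair uC u'C.
  exists (kbpr_sum Y Y'), v; split=> //; first exact: add_dsum.
  move=> l' Z N; rewrite inE => /orP[/eqP -> | l'L] CN ZN; apply: vP.
    by right; apply: u'l ZN.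
  by left; apply: uL ZN.
exists Y, u; split=> // Z.
elim=> {Z} [Q [N [l [CN QN]]] | | Z Z' ZZ' _ | Z Z' _ HZ _ HZ' | Z Z' _].
- have {}QN : placed (Q : kbpr Lambda) N (l * n%:Z).
    exact/derived_isoP/QN/kbpr_bounded_above/kbpr_projectives.
  have [lL | lL] := boolP (l \in L); first exact: uL lL CN QN.
  apply/factors_hom0/(hom0_placed_target _ _ QN)/hom0_stalk_zero/Xm.
  have : (m + absz e < absz l)%N by rewrite ltnNge; apply: contraNN lL; exact: LP.
  have : (absz l <= absz (l * n%:Z)%R)%N by rewrite abszM; exact: leq_pmulr.
  lia.
- by apply: factors_hom0 => f _; apply: null0 => i x; exact: rmod0_is_zero.
- exact/factors_retract/iso_retract.
- exact: factors_sum.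
- exact/factors_retract/retract_sum_left.
Qed.

Lemma cocone_bounded X Y e (u : gmap X Y) (uC : cyc e u) : bounded (cocone uC).
Proof.
have [m Xm] := kbpr_bounded X; have [m' Ym'] := kbpr_bounded Y.
exists (m + m' + absz e + 1)%N => i hi [x y].
by rewrite [x]Xm; [rewrite [y]Ym' //|]; lia.
Qed.

Definition kbpr_cocone X Y e (u : gmap X Y) (uC : cyc e u) : kbpr Lambda :=
  KbPr (cocone_bounded uC)
    (fun i => is_pr_prod (kbpr_pr X i) (kbpr_pr Y (i + (e - 1)))).

(** In the triangle Y0[e-1] -> T' -> T -> Y0[e], maps from C[nZ] to T lift to T' by rigidity, as 0 <
    e < n. A map T' -> Y[i] with i >= e comes from T; for i = e it then factors through u and
    becomes null on T', for i > e the induction hypothesis applies. *)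
Lemma right_approximation_step X (m : nat) : (m < n)%N ->
  exists T (p : gmap T X), [/\ cyc 0 p,
    forall Y, B Y -> forall b : gmap Y X, cyc 0 b ->
      exists c : gmap Y T, cyc 0 c /\ null 0 (gsub b (gcomp 0 p c)) &
    forall Y, B Y -> forall i : nat, (n - m <= i < n)%N -> hom0 i%:Z T Y].
Proof.
elim: m => [_ | m IH lt_mn].
  exists X, (gid X); split; first exact/cyc_id/gidE.
    move=> Y _ b bC; exists b; split=> //.
    by apply: null0 => i x; rewrite /gsub /gcomp /= !addr0 gidE /= subrr.
  by move=> Y _ i; lia.
have [T [p [pC pl TB]]] := IH (ltnW lt_mn).
pose e := (n - m.+1)%N.
have [Y0 [u [BY0 uC uP]]] := left_approximation T e.
have [p' [p'C p'E]] := cocone_projection uC.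
exists (kbpr_cocone uC), (gcomp 0 p p'); split.
- by have := cyc_comp pC p'C; rewrite addr0.
- move=> Y BY b bC; have [c [cC bc]] := pl Y BY b bC.
  have ucC : cyc e (gcomp 0 u c) by have := cyc_comp uC cC; rewrite add0r.
  have [|c' [c'C c'E]] := cocone_lift p'E cC _.
    by apply: (shifts_rigid n_gt0 gld C_ct BY BY0) ucC; rewrite /e; lia.
  exists c'; split=> //; apply: null_eq bc => i x.
  have := c'E i x; rewrite /gsub /gcomp /= !addr0 => ->.
  by [].
move=> Y BY i lt_in f fC.
have [g [gC fg]] : exists g : gmap T Y, cyc i g /\ null i (gsub f (gcomp 0 g p')).
  apply: (cocone_factor p'E fC); apply/hom0_shiftl.
  (* This degree lies between 1 and n - 1 because e <= i < n and e >= 1, so rigidity applies. *)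
  have -> : i%:Z - (e%:Z - 1) = (i - e + 1)%N%:Z by rewrite /e; lia.
  by apply: (shifts_rigid n_gt0 gld C_ct BY0 BY); rewrite /e; lia.
apply: null_of_sub fg _; have [ie | ne] := eqVneq i e.
  move: gC; rewrite ie => gC; have [h [hC hP]] := uP Y BY g gC.
  have n1 := gcomp_null_subl p'C hP; rewrite add0r in n1.
  apply: null_of_sub n1 _.
  have := null_compl hC (cocone_comp_null p'E); rewrite addr0.
  by apply: null_eq => j x; rewrite /gcomp /= !addr0.
have n1 : null i g by apply: TB => //; rewrite /e in ne; lia.
by have := null_compr p'C n1; rewrite add0r.
Qed.

(** After n - 1 steps all groups Hom(T, C[nZ][i]) with 0 < i < n vanish, and maximality puts T in
    C[nZ]. *)
Lemma right_approximation X : exists T (p : gmap T X), [/\ B T, cyc 0 p &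
  forall Y, B Y -> forall b : gmap Y X, cyc 0 b ->
    exists c : gmap Y T, cyc 0 c /\ null 0 (gsub b (gcomp 0 p c))].
Proof.
have [|T [p [pC pl TB]]] := @right_approximation_step X n.-1; first by lia.
exists T, p; split=> //; apply: (shifts_right n_gt0 gld C_ct) => Y BY i lt_in.
by apply: TB => //; lia.
Qed.

Lemma shifts_functorially_finite : functorially_finite B.
Proof.
split=> X.
  have [T [p [BT pC pl]]] := right_approximation X.
  have [F Fp] := chain_map_of_gmap pC; exists T, F; split=> // Y G BY.
  have [g Gg] := gmap_of_chain_map G; have [gC _] := Gg.
  have [c [cC gc]] := pl Y BY g gC; have [H Hc] := chain_map_of_gmap cC.
  exists H; apply/(homotopic_null (represents_comp Fp Hc) Gg); exact: null_sym.
have [Y [u [BY uC uP]]] := left_approximation X 0.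
have [F Fu] := chain_map_of_gmap uC; exists Y, F; split=> // Z G BZ.
have [g Gg] := gmap_of_chain_map G; have [gC _] := Gg.
have [h [hC gh]] := uP Z BZ g gC; have [H Hh] := chain_map_of_gmap hC.
exists H; apply/(homotopic_null (represents_comp Hh Fu) Gg); exact: null_sym.
Qed.

End Approximations.

Theorem theorem1p21 (k : fieldType) (Lambda : falgType k) (n : nat)
    (C : modcat Lambda -> Prop) :
  (1 <= n)%N -> gldim_le Lambda n -> abs_cluster_tilting n C ->
  cluster_tilting n (shifts n C).
Proof.
move=> n_gt0 gld C_ct; split.
- split; [exact: add_zero | exact: add_iso | exact: add_dsum |].
  exact: add_summand.
- exact: shifts_functorially_finite.
- move=> X; split=> [BX Y BY i lt_in | H].
    exact/hom_eq0P/(shifts_rigid n_gt0 gld C_ct BX BY).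
  apply: (shifts_right n_gt0 gld C_ct) => Y BY i lt_in.
  exact/hom_eq0P/H.
move=> X; split=> [BX Y BY i lt_in | H].
  exact/hom_eq0P/(shifts_rigid n_gt0 gld C_ct BY BX).
apply: (shifts_left n_gt0 gld C_ct) => Y BY i lt_in.
exact/hom_eq0P/H.
Qed.
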